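(* Let $W\in C^1(\mathbb{R})$ satisfy $W(-1)=W(1)=0$ and $W(s)>0$ for $s\neq\pm1$. Let $a:\mathbb{R}\to\mathbb{R}$ be measurable and such that there exist $a_1,a_2\in\mathbb{R}$ with $0<a_1\le a(t)\le a_2$ for all $t\in\mathbb{R}$. Suppose that there exists $b\in L^\infty(\mathbb{R})$ such that $a(t)\le b(t)$ for every $t\in\mathbb{R}$, $\lim_{|t|\to+\infty}\big(b(t)-a(t)\big)=0$, and $\inf_{\mathcal{X}_1}\mathcal{L}_b$ is attained. Then $\mathcal{L}_a$ attains its infimum over $\mathcal{X}_1$ at some $u_a\in\mathcal{X}_1$. Moreover, $u_a$ is a $C^1\cap W^{2,2}_{\mathrm{loc}}$ solution of $$\left(\frac{u'}{\sqrt{1-|u'|^2}}\right)'=a(t)W'(u)\quad\text{in }\mathbb{R},\qquad \lim_{t\to\pm\infty}\big(u(t),u'(t)\big)=(\pm1,0),$$ and $\|u_a'\|_{L^\infty}<1$.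
   Context: The space is $$\mathcal{X}_1=\Big\{u\in W^{1,\infty}(\mathbb{R})\ :\ \|u'\|_{L^\infty}\le1\ \text{ and }\ \lim_{t\to\pm\infty}u(t)=\pm1\Big\}.$$ For a weight $c:\mathbb{R}\to\mathbb{R}$ (here $c=a$ or $c=b$), the functional $\mathcal{L}_c$ is $$\mathcal{L}_c(u)=\int_{-\infty}^{+\infty}\Big(1-\sqrt{1-|u'|^2}+c(t)W(u)\Big)\,\mathrm{d}t .$$ *)

(* Defs.v *)
From HB Require Import structures.
From mathcomp Require Import all_boot all_order all_algebra.
From mathcomp Require Import all_classical all_reals all_analysis.

Set Implicit Arguments.
Unset Strict Implicit.
Unset Printing Implicit Defensive.

Import Order.TTheory GRing.Theory Num.Theory.
Import numFieldNormedType.Exports.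

Local Open Scope classical_set_scope.
Local Open Scope ring_scope.

Section sobolev.
Context {R : realType}.
Implicit Types (u g f phi : R -> R) (p : \bar R).

(* The library's [lebesgue_measure] only lives on the Borel sets. Measurability,
   integrals and essential suprema below all refer to the Lebesgue
   sigma-algebra, i.e. to the completed measure. *)
Definition leb_measurable f :=
  measurable_fun (T := caratheodory_type ((wlength (@idfun R))^*)%mu)
    [set: R] f.

Definition Linfty_norm f : \bar R :=
  'N[@completed_lebesgue_measure R]_+oo%E [EFin \o f].

Definition Lp p : set (R -> R) :=
  [set f | f \in Lfun (@completed_lebesgue_measure R) p].

Definition Lp_loc p : set (R -> R) :=
  [set f | leb_measurable f /\
    forall K : set R, compact K -> Lp p (f \_ K)].

Definition C1 f := (forall x, derivable f x 1) /\ continuous (derive1 f).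

Definition compactly_supported f := compact (closure [set x | f x != 0]).

(* In dimension one C^1 test functions are customary; smooth ones define the
   same weak derivative. *)
Definition weak_derivative u g :=
  [/\ Lp_loc 1 u, Lp_loc 1 g &
      forall phi, C1 phi -> compactly_supported phi ->
        (\int[@completed_lebesgue_measure R]_t (u t * derive1 phi t)%:E =
         - \int[@completed_lebesgue_measure R]_t (g t * phi t)%:E)%E].

(* A representative of the weak derivative, which is unique up to a.e.
   equality; junk if there is none. *)
Definition wderiv u : R -> R := get [set g | weak_derivative u g].

(* The functions having weak derivatives up to order k, all in L. *)
Fixpoint sobolev (L : set (R -> R)) (k : nat) (u : R -> R) : Prop :=
  L u /\ if k is k'.+1 then
    exists2 g, weak_derivative u g & sobolev L k' g else True.

Definition W1oo : set (R -> R) := [set u | sobolev (Lp +oo%E) 1 u].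

Definition W22_loc : set (R -> R) := [set u | sobolev (Lp_loc 2%:E) 2 u].

(* An element of W^{1,oo} is represented by its continuous representative, the
   one for which pointwise values and limits at infinity make sense. *)
Definition X1 : set (R -> R) :=
  [set u | [/\ continuous u, W1oo u, (Linfty_norm (wderiv u) <= 1)%E,
               u @ -oo --> (-1 : R) & u @ +oo --> (1 : R)]].

Definition lagrangian_action (W c u : R -> R) : \bar R :=
  (\int[@completed_lebesgue_measure R]_t
    (1 - Num.sqrt (1 - `|wderiv u t| ^+ 2) + c t * W (u t))%:E)%E.

Definition attains_inf_at (F : (R -> R) -> \bar R) (X : set (R -> R)) u :=
  X u /\ F u = ereal_inf [set F v | v in X].

End sobolev.

(* Main.v *)
Require Import Defs.
From HB Require Import structures.
From mathcomp Require Import all_boot all_order all_algebra.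
From mathcomp Require Import all_classical all_reals all_analysis.
From mathcomp Require Import measurable_realfun ess_sup_inf ring lra.
Import Order.TTheory GRing.Theory Num.Theory.
Import numFieldNormedType.Exports.
Local Open Scope classical_set_scope.
Local Open Scope ring_scope.

(** Functions in [X1] are 1-Lipschitz, so minimizing sequences are compact on
    bounded intervals, after a truncation to [[-1, 1]] that does not raise the energy.
    Two difficulties remain: the transition from -1 to 1 may escape to infinity,
    and the kinetic term is singular at speed one.

    Escape of the transition. The infimum for [a] is at most the one for [b],
    because [a <= b]. If they are equal, the minimizer for [b] is a minimizer
    for [a]. If the first is smaller, a near-minimizer cannot be close to [-1]
    far to the right: filling everything on its left with the constant [-1]
    (a short ramp joins the two pieces) costs little, and yields a function
    whose energy lives where [b - a] is small, so that its [b]-energy would be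
    below the infimum for [b]. This is [transition_window]; with the symmetric
    statement on the left it forces the limits at infinity of any limit of
    near-minimizers, which exists by [lip_compact].

    Singularity. Let [u] be a locally uniform limit of near-minimizers, and
    freeze the force [f = a W'(u)]. On a bounded interval the convex problem of
    minimizing the integral of [kinetic v' + f v] with given boundary values is
    solved explicitly by [v' = velocity (F + k)], where [F' = f] and the number
    [k] is adjusted to the boundary values; such a [k] exists as soon as the
    increment is smaller than the length, which holds on long intervals since
    [u] is bounded. Testing near-minimality of [w] against [w + s (v - w)] and
    using the strict convexity of [kinetic], made quantitative by
    [kinetic_dual_ge], shows that [w' - v'] is small in L^2 ([excess_le]).
    Hence the limit is itself such a [v] ([limit_eq]): it satisfies
    [u' = velocity (F + k)], which is at once the Euler-Lagrange equation, the
    bound [|u'| < 1] and the C^1 regularity. The same inequality gives lower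
    semicontinuity along the sequence ([limit_energy]), so [u] is a minimizer.

    Since [W o u] is integrable and Lipschitz it tends to 0, so [u] tends to
    the wells; then [u'], Lipschitz with convergent primitive, tends to 0 as
    well ([barbalat_pinfty]), whence [|u'|] is bounded away from 1.

    Weak derivatives are handled through the relation [primitive u g]: the
    function [u] is an indefinite integral of the locally bounded function [g].
    On the admissible class it is equivalent to weak differentiability
    ([weak_derivative_ftc], [primitive_weak_derivative]), and it is stable
    under composition, products and gluing. *)

Set Implicit Arguments.
Unset Strict Implicit.
Unset Printing Implicit Defensive.

Notation lebT R := (caratheodory_type ((wlength (@idfun R))^*)%mu).
Notation lam R := (@completed_lebesgue_measure R).

(** * Integrals over bounded intervals and their primitives *)

Section basics.
Context {R : realType}.
Implicit Types (u g f h : R -> R).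

Lemma borel_leb (A : set R) : measurable (A : set (measurableTypeR R)) ->
  measurable (A : set (lebT R)).
Proof. exact: sub_caratheodory. Qed.

Lemma leb_itv (i : interval R) : measurable ([set` i] : set (lebT R)).
Proof. by apply: borel_leb; exact: measurable_itv. Qed.

Lemma leb_id : leb_measurable (@id R).
Proof. by move=> _ A mA; rewrite setTI; exact: borel_leb. Qed.

Lemma leb_comp h f : continuous h -> leb_measurable f ->
  leb_measurable (fun t => h (f t)).
Proof.
move=> ch mf; apply: (@measurableT_comp _ _ _ _ _ _ h) => //.
exact: continuous_measurable_fun.
Qed.

Lemma lebD f g : leb_measurable f -> leb_measurable g ->
  leb_measurable (fun t => f t + g t).
Proof. by move=> mf mg; exact: measurable_funD. Qed.

Lemma lebM f g : leb_measurable f -> leb_measurable g ->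
  leb_measurable (fun t => f t * g t).
Proof. by move=> mf mg; exact: measurable_funM. Qed.

Lemma leb_continuous h : continuous h -> leb_measurable h.
Proof. by move=> ch; exact: leb_comp ch leb_id. Qed.

Lemma lam_oc x y : x <= y -> lam R `]x, y] = (y - x)%:E.
Proof.
move=> xy.
have -> : lam R `]x, y] = lebesgue_measure `]x, y] by [].
rewrite lebesgue_measure_itv /= lte_fin; case: ltP => // yx.
by have -> : x = y; [apply/eqP; rewrite eq_le xy yx|rewrite subrr].
Qed.

Definition locally_bounded g := forall N : R, exists B : R, forall t, `|t| <= N -> `|g t| <= B.

(** Half-open intervals make additivity and gluing hold without discarding
    endpoints. *)
Definition oc_int g x y : R := \int[lam R]_(t in `]x, y]) g t.

Definition loc_bdd g := leb_measurable g /\ locally_bounded g.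

Lemma leb_EFin (D : set (lebT R)) f : leb_measurable f ->
  measurable_fun (T := lebT R) D (EFin \o f).
Proof. by move=> mf; apply/measurable_EFinP; exact: measurable_funS mf. Qed.

Lemma EFin_ge0 (D : set (lebT R)) f : (forall t, 0 <= f t) ->
  forall t : lebT R, D t -> (0 <= (EFin \o f) t)%E.
Proof. by move=> f0 t _; rewrite lee_fin. Qed.

Lemma lam_le_int (D : set (lebT R)) f1 f2 : measurable D ->
  leb_measurable f1 -> leb_measurable f2 -> (forall t, 0 <= f1 t) ->
  (forall t, D t -> f1 t <= f2 t) ->
  (\int[lam R]_(t in D) (f1 t)%:E <= \int[lam R]_(t in D) (f2 t)%:E)%E.
Proof.
move=> mD m1 m2 f10 h.
apply: (@ge0_le_integral _ _ _ (lam R) D mD (EFin \o f1) (EFin \o f2)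
  (EFin_ge0 f10) (leb_EFin m1) (leb_EFin m2)).
by move=> t Dt /=; rewrite lee_fin; exact: h.
Qed.

Lemma lam_intD (D : set (lebT R)) f1 f2 : measurable D ->
  leb_measurable f1 -> leb_measurable f2 -> (forall t, 0 <= f1 t) -> (forall t, 0 <= f2 t) ->
  (\int[lam R]_(t in D) (f1 t + f2 t)%:E =
   \int[lam R]_(t in D) (f1 t)%:E + \int[lam R]_(t in D) (f2 t)%:E)%E.
Proof.
move=> mD m1 m2 f10 f20.
exact: (@ge0_integralD _ _ _ (lam R) D mD (EFin \o f1) (EFin \o f2)
  (EFin_ge0 f10) (leb_EFin m1) (EFin_ge0 f20) (leb_EFin m2)).
Qed.

Lemma loc_bdd_integrable g x y : loc_bdd g -> (lam R).-integrable `]x, y] (EFin \o g).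
Proof.
move=> [mg bg].
have [yx|xy] := leP y x; first by rewrite set_itv_ge ?bnd_simp -?leNgt//; exact: integrable_set0.
apply: measurable_bounded_integrable; first exact: leb_itv.
- by have e := lam_oc (ltW xy); rewrite [X in (X < _)%E]e ltry.
- exact: measurable_funS mg.
have [B hB] := bg (Num.max `|x| `|y|).
exists B; split; first exact: num_real.
move=> C BC t /=; rewrite in_itv/= => /andP[xt ty].
rewrite (le_trans _ (ltW BC))// hB// le_max.
have [t0|t0] := leP 0 t; apply/orP.
  by right; rewrite !ger0_norm; lra.
by left; rewrite !ltr0_norm; lra.
Qed.


Lemma eq_oc_int f g x y : (forall t, x < t <= y -> f t = g t) -> oc_int f x y = oc_int g x y.
Proof.
by move=> fg; apply: eq_Rintegral => t; rewrite inE/= in_itv/=; exact: fg.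
Qed.

Lemma oc_int_cat g x y z : loc_bdd g -> x <= y -> y <= z ->
  oc_int g x z = oc_int g x y + oc_int g y z.
Proof.
move=> lg xy yz; rewrite /oc_int.
have e : [set` `]x, z]] = [set` `]x, y]] `|` [set` `]y, z]].
  by rewrite -(@itv_bndbnd_setU _ _ (BRight x) (BRight y) (BRight z)) ?bnd_simp.
rewrite [in LHS]e Rintegral_setU//; [exact: leb_itv|exact: leb_itv| |].
  by rewrite -e; exact: loc_bdd_integrable.
apply/disj_setPRL => t /=; rewrite !in_itv/= => /andP[yt _] /andP[_ ty]; lra.
Qed.

Lemma oc_intD f g x y : loc_bdd f -> loc_bdd g ->
  oc_int (fun t => f t + g t) x y = oc_int f x y + oc_int g x y.
Proof.
by move=> lf lg; rewrite /oc_int RintegralD//; [exact: leb_itv|exact: loc_bdd_integrable..].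
Qed.

Lemma oc_intZ k g x y : loc_bdd g -> oc_int (fun t => k * g t) x y = k * oc_int g x y.
Proof. by move=> lg; rewrite /oc_int RintegralZl//; [exact: leb_itv|exact: loc_bdd_integrable]. Qed.

Lemma oc_int_cst k x y : x <= y -> oc_int (fun=> k) x y = k * (y - x).
Proof.
move=> xy; rewrite /oc_int Rintegral_cst; last exact: leb_itv.
by have e := lam_oc xy; rewrite [X in fine X]e.
Qed.

Lemma loc_bdd_bounded g B : leb_measurable g -> (forall t, `|g t| <= B) -> loc_bdd g.
Proof. by move=> mg gB; split => // N; exists B. Qed.

Lemma loc_bdd_cst k : loc_bdd (fun=> k).
Proof. by apply: (@loc_bdd_bounded _ `|k|) => //; exact: measurable_cst. Qed.

Lemma loc_bddD f g : loc_bdd f -> loc_bdd g -> loc_bdd (fun t => f t + g t).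
Proof.
move=> [mf bf] [mg bg]; split; first exact: measurable_funD.
move=> N; have [A hA] := bf N; have [B hB] := bg N; exists (A + B) => t tN.
by rewrite (le_trans (ler_normD _ _))// lerD ?hA ?hB.
Qed.

Lemma loc_bddM f g : loc_bdd f -> loc_bdd g -> loc_bdd (fun t => f t * g t).
Proof.
move=> [mf bf] [mg bg]; split; first exact: measurable_funM.
move=> N; have [A hA] := bf N; have [B hB] := bg N; exists (A * B) => t tN.
by rewrite normrM ler_pM// ?hA ?hB.
Qed.

Lemma loc_bddZ k g : loc_bdd g -> loc_bdd (fun t => k * g t).
Proof. by move=> lg; apply: loc_bddM => //; exact: loc_bdd_cst. Qed.

Lemma loc_bddB f g : loc_bdd f -> loc_bdd g -> loc_bdd (fun t => f t - g t).
Proof.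
move=> lf lg; have := loc_bddD lf (loc_bddZ (-1) lg).
by congr loc_bdd; apply/funext => t; rewrite mulN1r.
Qed.

Lemma oc_intB f g x y : loc_bdd f -> loc_bdd g ->
  oc_int (fun t => f t - g t) x y = oc_int f x y - oc_int g x y.
Proof.
by move=> lf lg; rewrite /oc_int RintegralB//; [exact: leb_itv|exact: loc_bdd_integrable..].
Qed.

Lemma loc_bdd_continuous h : continuous h -> loc_bdd h.
Proof.
move=> ch; split; first exact: leb_continuous.
move=> N; have [N0|N0] := ltP N 0.
  by exists 0 => t tN; have := normr_ge0 t; lra.
have cn : {within `[-N, N], continuous (fun t => `|h t|)}.
  apply: continuous_subspaceT => t; apply: continuous_comp; first exact: ch.
  exact: norm_continuous.
have [|c _ hc] := EVT_max _ cn; first by lra.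
by exists `|h c| => t; rewrite ler_norml => tN; apply: hc; rewrite in_itv.
Qed.

Lemma le_oc_int f g x y : loc_bdd f -> loc_bdd g -> (forall t, x < t <= y -> f t <= g t) ->
  oc_int f x y <= oc_int g x y.
Proof.
move=> lf lg fg; apply: le_Rintegral; [exact: leb_itv|exact: loc_bdd_integrable..|].
by move=> t /=; rewrite in_itv/=; exact: fg.
Qed.

Lemma oc_int_ge0 g x y : (forall t, x < t <= y -> 0 <= g t) -> 0 <= oc_int g x y.
Proof. by move=> g0; apply: Rintegral_ge0 => t /=; rewrite in_itv; exact: g0. Qed.

Lemma oc_int_bound g B x y : loc_bdd g -> x <= y -> (forall t, x < t <= y -> `|g t| <= B) ->
  `|oc_int g x y| <= B * (y - x).
Proof.
move=> lg xy gB; rewrite ler_norml; apply/andP; split.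
  rewrite -mulNr -oc_int_cst//; apply: le_oc_int => //; first exact: loc_bdd_cst.
  by move=> t /gB; rewrite ler_norml => /andP[].
rewrite -oc_int_cst//; apply: le_oc_int => //; first exact: loc_bdd_cst.
by move=> t /gB; rewrite ler_norml => /andP[].
Qed.

Definition primitive u g := loc_bdd g /\ forall x y, x <= y -> u y - u x = oc_int g x y.

Lemma primitive_lip u g B x y : primitive u g -> x <= y ->
  (forall t, x < t <= y -> `|g t| <= B) -> `|u y - u x| <= B * (y - x).
Proof. by move=> [lg ug] xy gB; rewrite ug//; exact: oc_int_bound. Qed.

Lemma primitive_lipT u g B x y : primitive u g -> (forall t, `|g t| <= B) ->
  `|u y - u x| <= B * `|y - x|.
Proof.
move=> ug gB; have [xy|/ltW yx] := leP x y.
  by rewrite (ger0_norm (_ : 0 <= y - x)) ?subr_ge0//; apply: (primitive_lip ug).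
rewrite distrC (distrC y).
by rewrite (ger0_norm (_ : 0 <= x - y)) ?subr_ge0//; apply: (primitive_lip ug).
Qed.

Lemma primitive_continuous u g : primitive u g -> continuous u.
Proof.
move=> ug x; have [_ bg] := ug.1; have [B hB] := bg (`|x| + 1).
have B0 : 0 <= B by apply: le_trans (hB x _); [exact: normr_ge0|lra].
apply/cvgrPdist_le => /= e e0.
exists (Num.min 1 (e / (B + 1))) => /=.
  by rewrite lt_min ltr01 divr_gt0//; lra.
move=> y /=; rewrite lt_min => /andP[xy1 xye].
have bnd (t : R) : `|x - t| <= `|x - y| -> `|g t| <= B.
  move=> ht; apply: hB; rewrite -(subKr x t) (le_trans (ler_normB _ _))//; lra.
have h : `|u x - u y| <= B * `|x - y|.
  have [yx|/ltW xly] := leP y x.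
    rewrite (ger0_norm (_ : 0 <= x - y)) ?subr_ge0//; apply: (primitive_lip ug) => // t /andP[t1 t2].
    by apply: bnd; rewrite !ger0_norm; lra.
  rewrite distrC (distrC x) (ger0_norm (_ : 0 <= y - x)) ?subr_ge0//.
  apply: (primitive_lip ug) => // t /andP[t1 t2].
  by apply: bnd; rewrite !ler0_norm; lra.
apply: (le_trans h); rewrite ltr_pdivlMr in xye; last lra.
by have := normr_ge0 (x - y); nra.
Qed.

(** The two branches give an oriented integral from 0. *)
Definition primitive_of g t := if 0 <= t then oc_int g 0 t else - oc_int g t 0.

Lemma primitive_ofP g : loc_bdd g -> primitive (primitive_of g) g.
Proof.
move=> lg; split => // x y xy; rewrite /primitive_of.
case: (leP 0 x) => x0; case: (leP 0 y) => y0.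
- by rewrite (oc_int_cat lg x0 xy) addrC addKr.
- by lra.
- by rewrite (oc_int_cat lg (ltW x0) y0) opprK addrC.
- by rewrite (oc_int_cat lg xy (ltW y0)) opprK addrC addrK.
Qed.

(** Both endpoints of the increment are free near [x]: this is what integral
    estimates provide, and it spares a case analysis on the side of [x]. *)
Lemma derive_of_o (D : R -> R) l x :
  (forall e, 0 < e -> exists2 d, 0 < d & forall lo hi, lo <= hi ->
     `|lo - x| < d -> `|hi - x| < d -> `|D hi - D lo - l * (hi - lo)| <= e * (hi - lo)) ->
  is_derive x (1 : R) D l.
Proof.
move=> h.
have c : (fun k => k^-1 *: (D (k *: 1 + x) - D x)) @ 0^' --> l.
  apply/cvgrPdist_le => e e0; have [d d0 hd] := h e e0.
  exists d => // k; rewrite /ball_ /= sub0r normrN => kd k0.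
  have -> : k *: 1 + x = k + x by rewrite /GRing.scale /= mulr1.
  have -> : l - k^-1 *: (D (k + x) - D x) = - (k^-1 * (D (k + x) - D x - l * k)).
    by rewrite /GRing.scale/=; field.
  rewrite normrN normrM normfV ler_pdivrMl ?normr_gt0//.
  have [k0'|k0'] := ltP k 0.
    have -> : D (k + x) - D x - l * k = - (D x - D (k + x) - l * (x - (k + x))) by ring.
    rewrite normrN (le_trans (hd _ _ _ _ _)) ?subrr ?normr0 ?addrK//; first by lra.
    by rewrite ltr0_norm// mulrC; lra.
  have -> : D (k + x) - D x - l * k = D (k + x) - D x - l * (k + x - x) by ring.
  rewrite (le_trans (hd _ _ _ _ _)) ?subrr ?normr0 ?addrK//; first by lra.
  by rewrite ger0_norm// mulrC; lra.
split; first by apply/cvg_ex; exists l.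
exact/cvg_lim.
Qed.

(** Identities between indefinite integrals are proved by applying this to the
    difference of the two sides. *)
Lemma const_of_o (D : R -> R) :
  (forall x e, 0 < e -> exists2 d, 0 < d & forall lo hi, lo <= hi ->
     `|lo - x| < d -> `|hi - x| < d -> `|D hi - D lo| <= e * (hi - lo)) ->
  forall x y, D x = D y.
Proof.
move=> h x y; apply: is_derive_0_is_cst => z; apply: derive_of_o => e e0.
have [d d0 hd] := h z e e0; exists d => // lo hi lohi hlo hhi.
by rewrite mul0r subr0 hd.
Qed.

Lemma derive_of_oc_int u g x r : 0 < r -> loc_bdd g ->
  (forall lo hi, lo <= hi -> `|lo - x| < r -> `|hi - x| < r -> u hi - u lo = oc_int g lo hi) ->
  {for x, continuous g} -> is_derive x (1 : R) u (g x).
Proof.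
move=> r0 lg ug cg; apply: derive_of_o => e e0.
move/cvgrPdist_le : cg => /(_ _ e0)[d /= d0 hd].
exists (Num.min d r) => [|lo hi lohi]; first by rewrite lt_min d0.
rewrite !lt_min => /andP[h1 r1] /andP[h2 r2].
rewrite ug// -oc_int_cst// -oc_intB//; last exact: loc_bdd_cst.
apply: oc_int_bound => //; first by apply: loc_bddB => //; exact: loc_bdd_cst.
move=> t /andP[t1 t2]; rewrite distrC; apply: hd => /=.
move: h1 h2; rewrite !ltr_norml; lra.
Qed.

Lemma primitive_derive u g x : primitive u g -> {for x, continuous g} -> is_derive x (1 : R) u (g x).
Proof. by move=> [lg ug]; apply: (@derive_of_oc_int _ _ _ 1) => // lo hi /ug. Qed.

(** Chain rule. By the mean value theorem an increment of [b o u] is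
    [b' c] times the integral of [g]; continuity of [b' o u] makes it differ
    from the integral of [b' (u t) * g t] by a higher order term, and
    [const_of_o] concludes. *)
Lemma primitive_comp (b b' : R -> R) u g :
  (forall x : R, is_derive x 1 b (b' x)) -> continuous b' -> primitive u g ->
  primitive (fun t => b (u t)) (fun t => b' (u t) * g t).
Proof.
move=> db cb' ug; have cu := primitive_continuous ug; have lg := ug.1.
have lbg : loc_bdd (fun t => b' (u t) * g t).
  by apply: loc_bddM => //; apply: loc_bdd_continuous => t; apply: continuous_comp; [exact: cu|exact: cb'].
have dp := primitive_ofP lbg; split => // x y xy.
suff: b (u x) - primitive_of (fun t => b' (u t) * g t) x = b (u y) - primitive_of (fun t => b' (u t) * g t) y.
  by rewrite -(dp.2 _ _ xy); lra.
apply: (const_of_o (D := fun t => b (u t) - primitive_of (fun t => b' (u t) * g t) t)).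
move=> {x y xy} x e e0 /=.
have [_ /(_ (`|x| + 1)) [B hB]] := lg.
have B0 : 0 <= B by apply: le_trans (hB x _); [exact: normr_ge0|lra].
have e20 : 0 < e / (2 * (B + 1)) by rewrite divr_gt0//; lra.
have := cb' (u x); move/cvgrPdist_le => /(_ _ e20)[r /= r0 hr].
have := cu x; move/cvgrPdist_lt => /(_ _ r0)[d /= d0 hd].
exists (Num.min 1 d); first by rewrite lt_min ltr01.
move=> lo hi lohi; rewrite !lt_min => /andP[lo1 lod] /andP[hi1 hid].
have near t : lo <= t <= hi -> `|x - t| < d /\ `|t| <= `|x| + 1.
  move=> /andP[t1 t2].
  have : `|x - t| < Num.min 1 d.
    by move: lo1 lod hi1 hid; rewrite lt_min !ltr_norml; lra.
  rewrite lt_min => /andP[a ->]; split => //.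
  by rewrite -(subKr x t) (le_trans (ler_normB _ _))//; lra.
have [c cin bc] : exists2 c, `|u x - c| < r & b (u hi) - b (u lo) = b' c * (u hi - u lo).
  have hl : `|u x - u lo| < r by apply: hd; apply: (near lo _).1; rewrite lexx.
  have hh : `|u x - u hi| < r by apply: hd; apply: (near hi _).1; rewrite lexx andbT.
  have cb : continuous b.
    by move=> t; apply/differentiable_continuous/derivable1_diffP; case: (db t).
  have [luh|/ltW luh] := leP (u lo) (u hi).
    have [c cin ->] := MVT_segment luh (fun z _ => db z) (continuous_subspaceT cb).
    exists c => //; move: cin hl hh; rewrite in_itv/= !ltr_norml; lra.
  have [c cin h] := MVT_segment luh (fun z _ => db z) (continuous_subspaceT cb).
  exists c; last by lra.
  move: cin hl hh; rewrite in_itv/= !ltr_norml; lra.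
have -> : b (u hi) - primitive_of (fun t => b' (u t) * g t) hi -
   (b (u lo) - primitive_of (fun t => b' (u t) * g t) lo) =
   oc_int (fun t => b' c * g t - b' (u t) * g t) lo hi.
  rewrite oc_intB ?oc_intZ -?(dp.2 _ _ lohi) -?(ug.2 _ _ lohi) -?bc//; first by ring.
  exact: loc_bddZ.
apply: oc_int_bound => //; first by apply: loc_bddB => //; exact: loc_bddZ.
move=> t /andP[/ltW t1 t2]; have [nt tx] := near t (introT andP (conj t1 t2)).
rewrite -mulrBl normrM.
have h1 := hr _ cin; have h2 := hr _ (hd _ nt).
have h3 : `|b' c - b' (u t)| <= e / (B + 1).
  have -> : b' c - b' (u t) = (b' (u x) - b' (u t)) - (b' (u x) - b' c) by ring.
  rewrite (le_trans (ler_normB _ _))// (le_trans (lerD h2 h1))//.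
  by rewrite le_eqVlt; apply/orP; left; apply/eqP; field; lra.
have h4 := hB _ tx.
rewrite (@le_trans _ _ (e / (B + 1) * B))// ?ler_pM//.
by rewrite mulrAC ler_pdivrMr ?ler_pM2l; move: e0 B0; clear; lra.
Qed.

Lemma eq_primitive u g u' g' : u =1 u' -> g =1 g' -> primitive u g -> primitive u' g'.
Proof. by move=> /funext -> /funext ->. Qed.

Lemma primitive_id : primitive id (fun=> 1).
Proof. by split; [exact: loc_bdd_cst|move=> x y xy; rewrite oc_int_cst// mul1r]. Qed.

Lemma primitive_cst k : primitive (fun=> k) (fun=> 0).
Proof. by split; [exact: loc_bdd_cst|move=> x y xy; rewrite oc_int_cst// mul0r subrr]. Qed.

Lemma primitiveD u g v h : primitive u g -> primitive v h ->
  primitive (fun t => u t + v t) (fun t => g t + h t).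
Proof.
move=> ug vh; split; first exact: loc_bddD ug.1 vh.1.
by move=> x y xy; rewrite (oc_intD _ _ ug.1 vh.1) -(ug.2 _ _ xy) -(vh.2 _ _ xy); ring.
Qed.

Lemma primitiveZ k u g : primitive u g -> primitive (fun t => k * u t) (fun t => k * g t).
Proof.
move=> ug; split; first exact: loc_bddZ ug.1.
by move=> x y xy; rewrite (oc_intZ _ _ _ ug.1) -(ug.2 _ _ xy); ring.
Qed.

Lemma primitiveB u g v h : primitive u g -> primitive v h ->
  primitive (fun t => u t - v t) (fun t => g t - h t).
Proof.
move=> ug vh; apply: eq_primitive (primitiveD ug (primitiveZ (-1) vh)) => t; ring.
Qed.

(** The fundamental theorem of calculus is the chain rule applied to the
    identity. *)
Lemma primitive_of_is_derive (f f' : R -> R) : (forall x : R, is_derive x 1 f (f' x)) -> continuous f' ->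
  primitive f f'.
Proof.
by move=> df cf; apply: eq_primitive (primitive_comp df cf primitive_id) => // t; rewrite mulr1.
Qed.

(** Polarization reduces the product rule, hence integration by parts, to the
    chain rule for the square. *)
Lemma primitiveM u g v h : primitive u g -> primitive v h ->
  primitive (fun t => u t * v t) (fun t => g t * v t + u t * h t).
Proof.
move=> ug vh.
have sq (w k : R -> R) : primitive w k -> primitive (fun t => w t ^+ 2) (fun t => 2 * w t * k t).
  move=> wk; apply: (@primitive_comp (fun x => x ^+ 2) (fun x => 2 * x)) => //.
    by move=> x; apply: is_derive_eq; rewrite /GRing.scale/=; ring.
  by move=> x; apply: cvgM; [exact: cvg_cst|exact: cvg_id].
apply: eq_primitive (primitiveZ (4^-1) (primitiveB (sq _ _ (primitiveD ug vh)) (sq _ _ (primitiveB ug vh)))) => t;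
  by field.
Qed.

Lemma leb_if c g h : leb_measurable g -> leb_measurable h ->
  leb_measurable (fun t => if t <= c then g t else h t).
Proof.
move=> mg mh; apply: measurable_fun_ifT; [|exact: mg|exact: mh].
have -> : (fun t : R => t <= c) = (fun t => t \in `]-oo, c]).
  by apply/funext => t; rewrite in_itv.
apply: (@measurable_fun_bool _ _ _ _ true).
rewrite (_ : _ `&` _ = [set` `]-oo, c]]); first exact: leb_itv.
by rewrite setTI; apply/seteqP; split => t /=.
Qed.

Lemma primitive_glue c u g v h : primitive u g -> primitive v h -> u c = v c ->
  primitive (fun t => if t <= c then u t else v t) (fun t => if t <= c then g t else h t).
Proof.
move=> ug vh uvc.
have lgh : loc_bdd (fun t => if t <= c then g t else h t).
  split; last first.
    move=> N; have [_ /(_ N)[A hA]] := ug.1; have [_ /(_ N)[B hB]] := vh.1.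
    exists (Num.max A B) => t tN; case: ifP => _; rewrite le_max ?hA ?hB ?orbT//.
  by apply: leb_if; [exact: ug.1.1|exact: vh.1.1].
split => // x y xy.
case: (leP y c) => [yc|cy]; first (case: (leP x c) => [xc|]; last lra).
  rewrite (ug.2 _ _ xy); apply: eq_oc_int => t /andP[_ ty].
  by rewrite (le_trans ty yc).
case: (leP x c) => [xc|cx]; last first.
  rewrite (vh.2 _ _ xy); apply: eq_oc_int => t /andP[xt _].
  by rewrite leNgt (lt_trans cx xt).
rewrite (oc_int_cat lgh xc (ltW cy)).
have -> : oc_int (fun t => if t <= c then g t else h t) x c = u c - u x.
  rewrite (ug.2 _ _ xc); apply: eq_oc_int => t /andP[_ tc]; by rewrite tc.
have -> : oc_int (fun t => if t <= c then g t else h t) c y = v y - v c.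
  rewrite (vh.2 _ _ (ltW cy)); apply: eq_oc_int => t /andP[ct _]; by rewrite leNgt ct.
by rewrite uvc; ring.
Qed.

End basics.

(** * Local integrability and uniqueness of densities *)

Section uniq.
Context {R : realType}.
Implicit Types (u g f h : R -> R).

Lemma loc_bdd_Lp_loc g (p : R) : 1 <= p -> loc_bdd g -> Lp_loc p%:E g.
Proof.
move=> p1 lg; split; first exact: lg.1.
move=> K cK.
have mK : measurable (K : set (lebT R)).
  by apply: borel_leb; apply: closed_measurable; apply: compact_closed cK; exact: Rhausdorff.
have [M [Mr hM]] := compact_bounded cK.
have {hM}hM : forall t, K t -> `|t| <= `|M| + 1.
  by move=> t Kt; apply: hM => //; rewrite (le_lt_trans (ler_norm M))// ltrDl.
have [B hB] := lg.2 (`|M| + 1).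
have B0 : 0 <= B.
  apply: le_trans (hB 0 _); rewrite ?normr_ge0// normr0; have := normr_ge0 M; lra.
have mgK : measurable_fun (T := lebT R) [set: lebT R] (g \_ K).
  by apply/(measurable_restrictT _ mK); exact: measurable_funS lg.1.
rewrite /Lp /= inE; apply/andP; split; first by rewrite inE.
rewrite inE /= /finite_norm unlock /Lnorm poweR_lty//.
have Kfin : (lam R K < +oo)%E.
  have sK : K `<=` [set` `]- (`|M| + 2), `|M| + 2]].
    by move=> t /hM /= tM; rewrite in_itv/=; move: tM; rewrite ler_norml; lra.
  apply: (@le_lt_trans _ _ (lam R [set` `]- (`|M| + 2), `|M| + 2]])).
    by apply: (@le_measure _ _ _ (lam R)) => //; rewrite inE//; exact: leb_itv.
  have MM : - (`|M| + 2) <= `|M| + 2 by have := normr_ge0 M; lra.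
  by have e := lam_oc MM; rewrite [X in (X < _)%E]e ltry.
rewrite [X in (X < _)%E](_ : _ = \int[lam R]_x (`|(g \_ K) x| `^ p)%:E)%E//.
apply: (@le_lt_trans _ _ (\int[lam R]_x (((cst (B `^ p)) \_ K) x)%:E)%E).
  apply: lam_le_int.
  - exact: measurableT.
  - apply: (@measurableT_comp _ _ _ _ _ _ (fun x => x `^ p)); first exact: measurable_powR.
    exact: measurableT_comp.
  - by apply/(measurable_restrictT _ mK); exact: measurable_cst.
  - by move=> t; exact: powR_ge0.
  - move=> t _; rewrite /patch; case: ifPn => [/set_mem Kt|_]; last first.
      by rewrite normr0 powR0//; lra.
    by apply: ge0_ler_powR; rewrite ?nnegrE//; [lra|exact/hB/hM].
rewrite -[X in integral _ _ X]/(EFin \o ((cst (B `^ p)) \_ K)) -restrict_EFin.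
rewrite -integral_mkcond (integral_cst _ mK (B `^ p)%:E).
by rewrite lte_mul_pinfty// lee_fin powR_ge0.
Qed.

Definition ioc_integrable g := forall x y, (lam R).-integrable `]x, y] (EFin \o g).

(** The sets over which [h] has zero integral form a Dynkin system containing
    the intervals, hence contain the Borel sets, and then the Lebesgue
    measurable ones, which differ from Borel sets by null sets. *)
Lemma ae0_of_oc_int h : leb_measurable h -> ioc_integrable h ->
  (forall x y, x <= y -> oc_int h x y = 0) -> {ae lam R, forall t, h t = 0}.
Proof.
move=> mh ih h0.
have eint x y : x <= y -> (\int[lam R]_(t in `]x, y]) (h t)%:E = 0)%E.
  move=> xy; rewrite -[LHS]fineK; last by apply: integrable_fin_num => //; exact: leb_itv.
  by have := h0 _ _ xy; rewrite /oc_int /Rintegral => ->.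
suff key : forall N : nat, {ae lam R, forall t, `]- (N%:R), N%:R]%classic t -> h t = 0}.
  have := ae_foralln key; apply: filterS => t ht.
  have [N hN] : exists N : nat, `|t| < N%:R by exists (Num.bound `|t|); apply: archi_boundP.
  by apply: (ht N); rewrite /= in_itv/=; move: hN; rewrite ltr_norml => /andP[->/ltW].
move=> N; pose D : set (lebT R) := `]- (N%:R), N%:R]%classic.
have mD : measurable D by exact: leb_itv.
have iD : (lam R).-integrable D (EFin \o h) by exact: ih.
have N0 : - (N%:R) <= N%:R :> R by have := ler0n R N; lra.
(* Restricting to D makes h integrable, so that complements can be taken. *)
pose H : set (set R) := [set A | measurable (A : set (lebT R)) /\
   (\int[lam R]_(t in A `&` D) (h t)%:E = 0)%E].
have isub (A : set (lebT R)) : measurable A -> A `<=` D -> (lam R).-integrable A (EFin \o h).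
  by move=> mA AD; exact: (integrableS mD mA AD iD).
(* Disjoint unions use countable additivity of the integral. *)
have dynH : dynkin H.
  split.
  - by split; [exact: measurableT|rewrite setTI; exact: eint].
  - move=> A [mA A0]; split; first exact: measurableC.
    have : (\int[lam R]_(t in (A `&` D) `|` (~` A `&` D)) (h t)%:E = 0)%E.
      by rewrite -setIUl setUv setTI; exact: eint.
    have mA1 : measurable (A `&` D : set (lebT R)) by exact: measurableI.
    have mA2 : measurable (~` A `&` D : set (lebT R)).
      by apply: measurableI => //; exact: measurableC.
    have dj : [disjoint A `&` D & ~` A `&` D] by apply/disj_setPRL => t /= [? _] [? _].
    have mU := @leb_EFin _ (A `&` D `|` ~` A `&` D) h mh.
    by rewrite (@integral_setU _ _ _ (lam R) _ _ _ mA1 mA2 mU dj) A0 add0e.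
  - move=> F tF HF; split; first by apply: bigcupT_measurable => k; exact: (HF k).1.
    rewrite setI_bigcupl integral_bigcup//.
    + by apply: eseries0 => i _ _; exact: (HF i).2.
    + by apply: (trivIset_setIr tF).
    + by move=> k; apply: measurableI => //; exact: (HF k).1.
    + apply: isub; last by move=> t [k _ []].
      by apply: bigcupT_measurable => k; apply: measurableI => //; exact: (HF k).1.
have bor (A : set R) : measurable (A : set (measurableTypeR R)) -> H A.
  have : <<s @ocitv R >> `<=` H.
    rewrite -setI_closed_g_dynkin_g_sigma_algebra; last exact: ocitvI.
    apply: smallest_sub => // _ [[a b] _ <-]; split; first exact: leb_itv.
    have -> : `]a, b]%classic `&` D = `]Num.max a (- N%:R), Num.min b N%:R]%classic.
      apply/seteqP; split => t; rewrite /D /= !in_itv/= gt_max le_min.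
        by move=> [/andP[-> ->] /andP[-> ->]].
      by move=> /andP[/andP[-> ->] /andP[-> ->]].
    have [ab|ba] := leP (Num.max a (- N%:R)) (Num.min b N%:R); first exact: eint.
    by rewrite set_itv_ge ?integral_set0// bnd_simp -leNgt ltW.
  exact.
have [|C [mC C0 hC]] := integral_ae_eq mD iD (measurable_cst (0 : \bar R)).
  move=> E ED mE; rewrite integral0.
  move: (mE); have <- := @completed_caratheodory_measurable R.
  rewrite g_sigma_completed_algebra_genE => -[A mA [N' [B [mB B0 NB]]]] AE.
  have AsE : A `<=` E by rewrite -AE; exact: subsetUl.
  have AD : A `&` D = A by apply: setIidl; exact: subset_trans ED.
  have mA' : measurable (A : set (lebT R)) by exact: borel_leb.
  have mB' : measurable (B : set (lebT R)) by exact: borel_leb.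
  rewrite (negligible_integral mB' mE)//; last exact: isub.
  have -> : E `\` B = A `\` B.
    rewrite -AE; apply/seteqP; split => t [].
      by move=> [At|/NB Bt] nB; split.
    by move=> At nB; split => //; left.
  rewrite -negligible_integral//; last by apply: isub => //; rewrite -AD; exact: subIsetr.
  by rewrite -AD; exact: (bor A mA).2.
exists C; split => // t /= ht; apply: hC => /= h'; apply: ht => Dt.
by have [] := h' Dt.
Qed.

End uniq.

(** * Weak derivatives and primitives *)

Section weak.
Context {R : realType}.
Implicit Types (u g f h phi : R -> R).

Lemma integral_supported f A B : leb_measurable f -> (lam R).-integrable `]A, B] (EFin \o f) ->
  (forall t, ~~ (A < t <= B) -> f t = 0) ->
  (\int[lam R]_t (f t)%:E = (oc_int f A B)%:E)%E.
Proof.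
move=> mf fi f0; rewrite /oc_int /Rintegral fineK; last first.
  by apply: integrable_fin_num => //; exact: leb_itv.
rewrite [RHS]integral_mkcond; apply: eq_integral => t _.
rewrite /patch; case: ifPn => //= tD; rewrite f0//.
by apply: contra tD => tAB; rewrite inE /= in_itv.
Qed.

Lemma supp_bounded phi : compactly_supported phi ->
  exists2 N, 0 <= N & forall t, N < `|t| -> phi t = 0.
Proof.
move=> /compact_bounded[M [Mr hM]]; exists (`|M| + 1); first by have := normr_ge0 M; lra.
move=> t tM; apply/eqP/negPn/negP => pt.
suff : `|t| <= `|M| + 1 by lra.
apply: hM; first by rewrite (le_lt_trans (ler_norm M))// ltrDl.
exact: subset_closure.
Qed.

Lemma C1_is_derive phi : C1 phi -> forall x, is_derive x (1 : R) phi (derive1 phi x).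
Proof. by move=> [d _] x; rewrite derive1E; apply: derivableP. Qed.

Lemma is_derive_derive1 phi (x l : R) : is_derive x (1 : R) phi l -> derive1 phi x = l.
Proof. by move=> h; rewrite derive1E; exact: derive_val. Qed.

Lemma C1_of_derive phi d : (forall x, is_derive x (1 : R) phi (d x)) -> continuous d ->
  C1 phi /\ derive1 phi = d.
Proof.
move=> h cd; have e : derive1 phi = d by apply/funext => x; exact: is_derive_derive1.
by split=> //; split; rewrite ?e// => x; case: (h x).
Qed.

Lemma C1_primitive phi : C1 phi -> primitive phi (derive1 phi).
Proof. by move=> h; apply: primitive_of_is_derive h.2; exact: C1_is_derive. Qed.

Lemma derive1_supp phi N : (forall t, N < `|t| -> phi t = 0) ->
  forall t, N < `|t| -> derive1 phi t = 0.
Proof.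
move=> h t tN; apply: is_derive_derive1; apply: derive_of_o => e e0.
exists (`|t| - N); first by rewrite subr_gt0.
move=> lo hi lohi hlo hhi.
have nr s : `|s - t| < `|t| - N -> phi s = 0.
  by move=> st; apply: h; have := ler_distD s 0 t; rewrite !sub0r !normrN; lra.
by rewrite mul0r subr0 !nr// subrr normr0 mulr_ge0 ?subr_ge0// ltW.
Qed.

(** Integration by parts against a test function. *)
Lemma primitive_weak_derivative u g : primitive u g -> weak_derivative u g.
Proof.
move=> ug; have cu := primitive_continuous ug; split.
- by apply: loc_bdd_Lp_loc => //; exact: loc_bdd_continuous.
- by apply: loc_bdd_Lp_loc => //; exact: ug.1.
move=> phi c1 /supp_bounded[N N0 hN].
have d1 := derive1_supp hN.
have pd := C1_primitive c1.
have l1 : loc_bdd (fun t => u t * derive1 phi t).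
  by apply: loc_bddM; [exact: loc_bdd_continuous|exact: pd.1].
have l2 : loc_bdd (fun t => g t * phi t).
  by apply: loc_bddM; [exact: ug.1|apply: loc_bdd_continuous; exact: primitive_continuous pd].
have out t : ~~ (- (N + 1) < t <= N + 1) -> N < `|t|.
  move=> /negP h; rewrite ltNge; apply/negP; rewrite ler_norml => h'; apply: h; lra.
rewrite (integral_supported (A := - (N + 1)) (B := N + 1) l1.1 (loc_bdd_integrable _ _ l1)); last first.
  by move=> t /out tN; rewrite d1// mulr0.
rewrite (integral_supported (A := - (N + 1)) (B := N + 1) l2.1 (loc_bdd_integrable _ _ l2)); last first.
  by move=> t /out tN; rewrite hN// mulr0.
rewrite -EFinN; congr EFin.
have NN : - (N + 1) <= N + 1 by lra.
have := (primitiveM ug pd).2 _ _ NN; rewrite (oc_intD _ _ l2 l1).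
by rewrite !hN ?mulr0; [lra|rewrite normrN ger0_norm; lra|rewrite ger0_norm; lra].
Qed.

(** A smoothed step: [S] climbs from 0 to 1 on [[0, e]]. Differences of its
    translates are the test functions that single out an interval. *)
Lemma bump (e : R) : 0 < e -> exists S r : R -> R,
  [/\ continuous r, primitive S r, forall t, 0 <= r t,
      forall t, ~~ (0 < t < e) -> r t = 0 &
      (forall t, t <= 0 -> S t = 0) /\ (forall t, e <= t -> S t = 1)].
Proof.
move=> e0; pose p t : R := Num.max 0 (e / 2 - `|t - e / 2|).
have cp : continuous p.
  move=> t; apply: (@continuous_max _ _ (fun=> 0) (fun t => e / 2 - `|t - e / 2|)).
    exact: cvg_cst.
  apply: cvgB; first exact: cvg_cst.
  by apply: cvg_norm; apply: cvgB; [exact: cvg_id|exact: cvg_cst].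
have lp := loc_bdd_continuous cp.
have p0 t : 0 <= p t by rewrite /p le_max lexx.
have pout t : ~~ (0 < t < e) -> p t = 0.
  move=> /negP h; apply/max_idPl; rewrite subr_le0 leNgt; apply/negP.
  by rewrite ltr_norml => h'; apply: h; lra.
set k := oc_int p 0 e.
have k0 : 0 < k.
  have -> : k = oc_int p 0 (e / 4) + (oc_int p (e / 4) (3 * e / 4) + oc_int p (3 * e / 4) e).
    by rewrite /k -!oc_int_cat//; lra.
  have := @oc_int_ge0 _ p 0 (e / 4) (fun t _ => p0 t).
  have := @oc_int_ge0 _ p (3 * e / 4) e (fun t _ => p0 t).
  suff : e / 4 * (3 * e / 4 - e / 4) <= oc_int p (e / 4) (3 * e / 4) by nra.
  rewrite -oc_int_cst; last by lra.
  apply: le_oc_int => //; first exact: loc_bdd_cst.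
  move=> t ht; rewrite /p le_max; apply/orP; right.
  suff : `|t - e / 2| <= e / 4 by lra.
  by rewrite ler_norml; lra.
exists (fun t => k^-1 * primitive_of p t), (fun t => k^-1 * p t); split.
- by move=> t; apply: cvgM; [exact: cvg_cst|exact: cp].
- exact/primitiveZ/primitive_ofP.
- by move=> t; rewrite mulr_ge0// invr_ge0 ltW.
- by move=> t /pout ->; rewrite mulr0.
split=> t ht.
  have -> : primitive_of p t = 0; last by rewrite mulr0.
  have := (primitive_ofP lp).2 _ _ ht.
  have -> : primitive_of p 0 = 0 by rewrite /primitive_of lexx; have := oc_int_cat lp (lexx 0) (lexx 0); lra.
  have -> : oc_int p t 0 = oc_int (fun=> 0) t 0; last by rewrite oc_int_cst//; lra.
  by apply: eq_oc_int => s hs; apply: pout; apply/negP; lra.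
have -> : primitive_of p t = k; last by rewrite mulVf// gt_eqF.
have t0 : 0 <= t by lra.
rewrite /primitive_of t0 (oc_int_cat lp (ltW e0) ht) -/k.
have -> : oc_int p e t = oc_int (fun=> 0) e t; last by rewrite oc_int_cst//; lra.
by apply: eq_oc_int => s hs; apply: pout; apply/negP; lra.
Qed.

Lemma Lp_loc1_int g x y : Lp_loc 1 g -> (lam R).-integrable `]x, y] (EFin \o g).
Proof.
move=> [mg hg].
have /Lfun1_integrable := hg _ (@segment_compact R x y).
rewrite -restrict_EFin => h.
have : (lam R).-integrable `[x, y] (EFin \o g).
  by apply/(@integrable_mkcond _ _ _ (lam R) _ (EFin \o g) (leb_itv `[x, y])).
apply: integrableS; [exact: leb_itv|exact: leb_itv|].
by move=> t /=; rewrite !in_itv/= => /andP[/ltW -> ->].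
Qed.

Lemma shift_derive (S r : R -> R) (c x : R) : is_derive (x - c) (1 : R) S (r (x - c)) ->
  is_derive x (1 : R) (fun t => S (t - c)) (r (x - c)).
Proof.
move=> h; have h1 : is_derive x (1 : R) (fun t : R => t - c) 1.
  by apply: is_derive_eq; rewrite subr0.
by have := @is_derive1_comp _ S (fun t : R => t - c) x _ _ h h1; rewrite mulr1.
Qed.

(** Test with [S (t - x) - S (t - y)], where [S] is a step smoothed at scale
    [e n]: its derivative tends to a difference of Dirac masses, which picks the
    values of the continuous function [u], and it tends boundedly to the
    indicator of [(x, y]]. *)
Lemma weak_derivative_ftc u g : continuous u -> weak_derivative u g ->
  forall x y, x <= y -> u y - u x = oc_int g x y.
Proof.
move=> cu [_ lg wug] x y xy; have mg := lg.1.
pose e (n : nat) : R := n.+1%:R^-1.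
have e0 n : 0 < e n by rewrite invr_gt0.
have e1 n : e n <= 1 by rewrite invf_le1// ler1n.
pose S n := projT1 (cid (bump (e0 n))).
pose r n := projT1 (cid (projT2 (cid (bump (e0 n))))).
have P n : [/\ continuous (r n), primitive (S n) (r n), forall t, 0 <= r n t,
      forall t, ~~ (0 < t < e n) -> r n t = 0 &
      (forall t, t <= 0 -> S n t = 0) /\ (forall t, e n <= t -> S n t = 1)].
  by rewrite /r; case: (cid (projT2 (cid (bump (e0 n))))).
pose phi n t := S n (t - x) - S n (t - y).
pose dphi n t := r n (t - x) - r n (t - y).
have dS n c z : is_derive z (1 : R) (fun t => S n (t - c)) (r n (z - c)).
  have [cr ds _ _ _] := P n; apply: shift_derive; apply: primitive_derive ds _; exact: cr.
have crs n c : continuous (fun t => r n (t - c)).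
  have [cr _ _ _ _] := P n.
  move=> t; apply: (@continuous_comp _ _ _ (fun t => t - c) (r n)); last exact: cr.
  by apply: cvgB; [exact: cvg_id|exact: cvg_cst].
have cd n : continuous (dphi n) by move=> t; apply: cvgB; exact: crs.
have [c1 dE] : (forall n, C1 (phi n)) /\ forall n, derive1 (phi n) = dphi n.
  by split=> n; have [] := @C1_of_derive (phi n) (dphi n) (fun z => is_deriveB (dS n x z) (dS n y z)) (cd n).
have dsS n c : primitive (fun t => S n (t - c)) (fun t => r n (t - c)) by exact: primitive_of_is_derive.
have Smono n s t : s <= t -> S n s <= S n t.
  have [_ ds r0 _ _] := P n => st; rewrite -subr_ge0 (ds.2 _ _ st); exact: oc_int_ge0.
have S01 n t : 0 <= S n t <= 1.
  have [_ _ _ _ [SL SR]] := P n.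
  rewrite -(SL (Num.min t 0)) ?ge_min ?lexx ?orbT// -(SR (Num.max t (e n))) ?le_max ?lexx ?orbT//.
  by rewrite !Smono// ?ge_min ?le_max lexx.
have phi1 n t : `|phi n t| <= 1.
  by rewrite ler_norml /phi; have := S01 n (t - x); have := S01 n (t - y); lra.
have phiout n t : ~~ (x < t <= y + 1) -> phi n t = 0.
  have [_ _ _ _ [SL SR]] := P n; rewrite /phi => /negP h.
  have [tx|xt] := leP t x; first by rewrite !SL; lra.
  have yt : y + 1 < t by rewrite ltNge; apply/negP => ty; apply: h; rewrite xt.
  by have := e1 n => e1n; rewrite !SR; lra.
have dphiout n t : ~~ (x < t <= y + 1) -> dphi n t = 0.
  have [_ _ _ rout _] := P n; rewrite /dphi => /negP h.
  by have := e1 n => e1n; rewrite !rout ?subrr//; apply/negP => h'; apply: h; lra.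
have supp n : compactly_supported (phi n).
  apply: (subclosed_compact _ (@segment_compact R x (y + 1))); first exact: closed_closure.
  rewrite [X in _ `<=` X](closure_id _).1; last exact: interval_closed.
  apply: closureS.
  move=> t /= pt; rewrite in_itv/=.
  have : x < t <= y + 1 by apply: contraNT pt => /phiout ->.
  by move=> /andP[/ltW -> ->].
have x1 : x <= y + 1 by lra.
have mphi n : leb_measurable (phi n).
  by apply: leb_continuous => t; apply: cvgB; apply: (primitive_continuous (dsS n _)).
have lu n : loc_bdd (fun t => u t * dphi n t) by apply: loc_bddM; exact: loc_bdd_continuous.
have ig : (lam R).-integrable `]x, y + 1] (EFin \o g) by exact: Lp_loc1_int.
have mgphi n : leb_measurable (fun t => g t * phi n t) by apply: measurable_funM; [exact: mg|exact: mphi].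
have igphi n : (lam R).-integrable `]x, y + 1] (EFin \o (fun t => g t * phi n t)).
  apply: le_integrable ig; first exact: leb_itv.
    by apply/measurable_EFinP; exact: measurable_funS (mgphi n).
  move=> t _ /=; rewrite lee_fin normrM.
  by rewrite ler_piMr.
have E n : oc_int (fun t => u t * dphi n t) x (y + 1) = - oc_int (fun t => g t * phi n t) x (y + 1).
  have := wug _ (c1 n) (supp n); rewrite dE.
  rewrite (integral_supported (lu n).1 (loc_bdd_integrable x (y + 1) (lu n))); last by move=> t /dphiout ->; rewrite mulr0.
  rewrite (integral_supported (mgphi n) (igphi n)); last by move=> t /phiout ->; rewrite mulr0.
  by rewrite -EFinN => -[].
(* The derivative of the step is a unit mass within e n of its origin. *)
have L1 : (fun n => oc_int (fun t => u t * dphi n t) x (y + 1)) @ \oo --> u x - u y.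
  have one c : x <= c <= y -> (fun n => oc_int (fun t => u t * r n (t - c)) x (y + 1)) @ \oo --> u c.
    move=> xcy; apply/cvgrPdist_le => eps eps0.
    have := cu c; move/cvgrPdist_le => /(_ _ eps0)[d /= d0 hd].
    near=> n.
    have end_ : e n < d by near: n; exact: near_infty_natSinv_lt (PosNum d0).
    have [_ _ r0 rout [SL SR]] := P n.
    have lr : loc_bdd (fun t => r n (t - c)) by exact: loc_bdd_continuous.
    have tot : oc_int (fun t => r n (t - c)) x (y + 1) = 1.
      by rewrite -((dsS n c).2 _ _ x1) (SR (_ + _ - c)) ?(SL (x - c)) ?subr0//; have := e1 n; lra.
    have luc : loc_bdd (fun t => u t * r n (t - c)) by apply: loc_bddM => //; exact: loc_bdd_continuous.
    have -> : u c - oc_int (fun t => u t * r n (t - c)) x (y + 1) =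
       oc_int (fun t => u c * r n (t - c) - u t * r n (t - c)) x (y + 1).
      by rewrite oc_intB ?oc_intZ// ?tot ?mulr1//; exact: loc_bddZ.
    have ptw t : `|u c * r n (t - c) - u t * r n (t - c)| <= eps * r n (t - c).
      rewrite -mulrBl normrM (ger0_norm (r0 _)).
      have [tc|ntc] := boolP (0 < t - c < e n); last by rewrite rout// !mulr0.
      apply: ler_wpM2r => //; apply: hd => /=; rewrite ltr_norml; lra.
    have l2 : loc_bdd (fun t => eps * r n (t - c)) by exact: loc_bddZ.
    have l1 : loc_bdd (fun t => u c * r n (t - c) - u t * r n (t - c)) by apply: loc_bddB => //; exact: loc_bddZ.
    have l3 : loc_bdd (fun t => - eps * r n (t - c)) by exact: loc_bddZ.
    have -> : eps = oc_int (fun t => eps * r n (t - c)) x (y + 1) by rewrite oc_intZ// tot mulr1.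
    rewrite ler_norml.
    have -> : - oc_int (fun t => eps * r n (t - c)) x (y + 1) = oc_int (fun t => - eps * r n (t - c)) x (y + 1).
      by rewrite !oc_intZ// mulNr.
    by apply/andP; split; apply: le_oc_int => // t _; have := ptw t; rewrite ler_norml ?mulNr => /andP[].
  have hx : x <= x <= y by rewrite lexx.
  have hy : x <= y <= y by rewrite lexx xy.
  have -> : (fun n => oc_int (fun t => u t * dphi n t) x (y + 1)) =
      (fun n => oc_int (fun t => u t * r n (t - x)) x (y + 1) - oc_int (fun t => u t * r n (t - y)) x (y + 1)).
    apply/funext => n; rewrite -oc_intB; last 2 first.
    - by apply: loc_bddM; exact: loc_bdd_continuous.
    - by apply: loc_bddM; exact: loc_bdd_continuous.
    by congr oc_int; apply/funext => t; rewrite /dphi mulrBr.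
  exact: cvgB (one x hx) (one y hy).
have L2 : (fun n => oc_int (fun t => g t * phi n t) x (y + 1)) @ \oo --> oc_int g x y.
  pose gy t := if t <= y then g t else 0.
  have mgy : leb_measurable gy by apply: leb_if => //; exact: measurable_cst.
  have -> : oc_int g x y = oc_int gy x (y + 1).
    rewrite /oc_int /Rintegral; congr fine.
    rewrite integral_mkcond [RHS]integral_mkcond; apply: eq_integral => t _.
    rewrite /patch !mem_setE /gy !in_itv /=.
    case: (x < t) => //=; case: (leP t y) => ty /=; first by rewrite (_ : t <= y + 1)//; lra.
    by case: ifP.
  have [|||||+ _ +] := @dominated_convergence _ _ _ (lam R) `]x, y + 1] (leb_itv _)
    (fun n => EFin \o (fun t => g t * phi n t)) (EFin \o gy) (abse \o (EFin \o g)).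
  - by move=> n; apply/measurable_EFinP; exact: measurable_funS (mgphi n).
  - by apply/measurable_EFinP; exact: measurable_funS mgy.
  - apply: nearW => t /=; rewrite in_itv/= => /andP[xt ty1].
    apply/cvg_EFin; first by apply: nearW.
    have tx0 : 0 < t - x by lra.
    apply: (@cvg_near_cst _ _ _ _ _ _); rewrite /= /gy /phi.
    case: leP => ty.
      near=> n; have [_ _ _ _ [SL SR]] := P n.
      rewrite (SR (t - x)) ?(SL (t - y)) ?subr0 ?mulr1//; first by lra.
      by rewrite ltW//; near: n; exact: near_infty_natSinv_lt (PosNum tx0).
    have ty0 : 0 < t - y by lra.
    near=> n; have [_ _ _ _ [SL SR]] := P n.
    have en : e n <= t - y.
      by rewrite ltW//; near: n; exact: near_infty_natSinv_lt (PosNum ty0).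
    by rewrite !SR ?subrr ?mulr0//; lra.
  - exact: integrable_abse.
  - apply: nearW => t n _ /=; rewrite lee_fin normrM ler_piMr//.
  move=> igy cv; apply: fine_cvg; rewrite fineK//.
  by apply: integrable_fin_num => //; exact: leb_itv.
have L3 : (fun n => oc_int (fun t => u t * dphi n t) x (y + 1)) @ \oo --> - oc_int g x y.
  by under eq_fun do rewrite E; exact: cvgN.
have := cvg_unique (@Rhausdorff R) L1 L3.
by move=> h; apply/eqP; rewrite -[oc_int g x y]opprK -h opprB.
Unshelve. all: by end_near. Qed.

End weak.

(** * The relativistic kinetic energy *)

Section kinetic.
Context {R : realType}.
Implicit Types (p q s x y : R).

(** The relativistic kinetic energy; outside [[-1, 1]] it is constantly 1. *)
Definition kinetic p : R := 1 - Num.sqrt (1 - `|p| ^+ 2).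

(** The inverse of [p |-> p / sqrt (1 - p ^ 2)], the derivative of
    [kinetic]. *)
Definition velocity x : R := x / Num.sqrt (1 + x ^+ 2).

Let sq_abs p : `|p| ^+ 2 = p ^+ 2.
Proof. by rewrite -normrX ger0_norm// sqr_ge0. Qed.

Let sqE p : `|p| <= 1 -> 0 <= 1 - p ^+ 2.
Proof. by rewrite ler_norml => h; nra. Qed.

Lemma kinetic_ge0 p : 0 <= kinetic p.
Proof.
rewrite /kinetic subr_ge0 sq_abs -[leRHS]sqrtr1 ler_sqrt//; have := sqr_ge0 p; lra.
Qed.

Lemma kinetic_le1 p : kinetic p <= 1.
Proof. by rewrite /kinetic; have := sqrtr_ge0 (1 - `|p| ^+ 2); lra. Qed.

Lemma kinetic0 : kinetic 0 = 0.
Proof. by rewrite /kinetic normr0 expr0n subr0 sqrtr1 subrr. Qed.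

Lemma kinetic_continuous : continuous kinetic.
Proof.
move=> p; apply: cvgB; first exact: cvg_cst.
apply: (@continuous_comp _ _ _ (fun p : R => 1 - `|p| ^+ 2) Num.sqrt); last exact: sqrt_continuous.
apply: cvgB; first exact: cvg_cst.
apply: (@continuous_comp _ _ _ (fun p : R => `|p|) (fun x : R => x ^+ 2)); first exact: norm_continuous.
exact: exprn_continuous.
Qed.

Let root_gt0 x : 0 < 1 + x ^+ 2.
Proof. by have := sqr_ge0 x; lra. Qed.

Let root x := Num.sqrt (1 + x ^+ 2).

Let rootP x : 1 <= root x /\ root x ^+ 2 = 1 + x ^+ 2.
Proof.
have h := root_gt0 x; split; last by rewrite sqr_sqrtr// ltW.
by rewrite -[leLHS]sqrtr1 ler_sqrt//; have := sqr_ge0 x; lra.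
Qed.

Let velocityE x : [/\ velocity x * root x = x, 1 - velocity x ^+ 2 = (root x)^-1 ^+ 2 & 0 < (root x)^-1].
Proof.
have [r1 r2] := rootP x; have r0 : root x != 0 by apply/eqP; lra.
have e : velocity x * root x = x by rewrite divfK.
split=> //; last by rewrite invr_gt0; lra.
have -> : velocity x = x / root x by [].
rewrite expr_div_n exprVn r2; field.
by rewrite gt_eqF.
Qed.

Lemma velocity_lt1 x : `|velocity x| < 1.
Proof.
have [_ e h] := velocityE x; rewrite ltr_norml.
have : 0 < (root x)^-1 ^+ 2 by rewrite exprn_gt0.
by rewrite -e => ?; nra.
Qed.

Let sqrt_velocity x : Num.sqrt (1 - `|velocity x| ^+ 2) = (root x)^-1.
Proof. by have [_ e h] := velocityE x; rewrite sq_abs e sqrtr_sqr gtr0_norm. Qed.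

Lemma velocityK x : velocity x / Num.sqrt (1 - `|velocity x| ^+ 2) = x.
Proof. by rewrite sqrt_velocity invrK; case: (velocityE x). Qed.

(** The supporting line of [kinetic] at [velocity x] has slope [x]; the square
    on the left is the uniform convexity coming from [kinetic'' >= 1]. Write
    [q = velocity x], and [c], [d] for the square roots of [1 - p ^ 2] and
    [1 - q ^ 2]: the points [(p, c)] and [(q, d)] lie on the unit circle, and
    the difference of the two sides is a nonnegative combination of the squares
    of [p - q] and [c - d]. *)
Lemma kinetic_dual_ge x p : `|p| <= 1 ->
  kinetic (velocity x) + x * (p - velocity x) + (p - velocity x) ^+ 2 / 2 <= kinetic p.
Proof.
move=> p1; rewrite /kinetic sqrt_velocity sq_abs.
have [r1 r2] := rootP x.
have [e1 e2 e3] := velocityE x.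
set q := velocity x in e1 e2 *; set r := root x in r1 r2 e1 e2 e3 *.
set d := r^-1 in e2 e3 *.
have c0 := sqrtr_ge0 (1 - p ^+ 2); have c2 := sqr_sqrtr (sqE p1).
set c := Num.sqrt _ in c0 c2 *.
have dr : d * r = 1 by rewrite mulVf// gt_eqF//; lra.
have d1 : d <= 1 by nra.
have xd : x * d = q by rewrite -e1 -mulrA [r * d]mulrC dr mulr1.
rewrite -subr_ge0 -(pmulr_rge0 _ e3).
have -> : d * (1 - c - (1 - d + x * (p - q) + (p - q) ^+ 2 / 2)) =
  d ^+ 2 - d * c - (x * d) * (p - q) - d * (p - q) ^+ 2 / 2 by ring.
rewrite xd.
have -> : d ^+ 2 - d * c - q * (p - q) - d * (p - q) ^+ 2 / 2 =
   ((p - q) ^+ 2 * (1 - d) + (c - d) ^+ 2) / 2.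
  have h : c ^+ 2 + p ^+ 2 = d ^+ 2 + q ^+ 2 by rewrite c2 -e2; ring.
  have h' : d ^+ 2 + q ^+ 2 = 1 by rewrite -e2; ring.
  nra.
have h1 : 0 <= (p - q) ^+ 2 * (1 - d) by rewrite mulr_ge0 ?sqr_ge0//; lra.
by have := sqr_ge0 (c - d); lra.
Qed.

(** Concavity of the upper half of the unit circle. *)
Lemma kinetic_convex p q s : `|p| <= 1 -> `|q| <= 1 -> 0 <= s <= 1 ->
  kinetic (p + s * (q - p)) <= kinetic p + s * (kinetic q - kinetic p).
Proof.
move=> p1 q1 /andP[s0 s1]; rewrite /kinetic !sq_abs.
have c0 := sqrtr_ge0 (1 - p ^+ 2); have c2 := sqr_sqrtr (sqE p1).
set c := Num.sqrt (1 - p ^+ 2) in c0 c2 *.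
have d0 := sqrtr_ge0 (1 - q ^+ 2); have d2 := sqr_sqrtr (sqE q1).
set d := Num.sqrt (1 - q ^+ 2) in d0 d2 *.
suff : c + s * (d - c) <= Num.sqrt (1 - (p + s * (q - p)) ^+ 2) by lra.
have n0 : 0 <= c + s * (d - c) by nra.
rewrite -[leLHS]ger0_norm// -sqrtr_sqr ler_wsqrtr//.
have h : p * q + c * d <= 1 by have := sqr_ge0 (p - q); have := sqr_ge0 (c - d); nra.
have -> : (c + s * (d - c)) ^+ 2 = (1 - s) ^+ 2 * c ^+ 2 + s ^+ 2 * d ^+ 2 + 2 * s * (1 - s) * (c * d) by ring.
rewrite c2 d2.
have : 0 <= s * (1 - s) by nra.
nra.
Qed.

Lemma velocity_derive x : is_derive x (1 : R) velocity (Num.sqrt (1 + x ^+ 2) ^- 3).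
Proof.
have [r1 r2] := rootP x; have r0 : root x != 0 by apply/eqP; lra.
have h1 : is_derive x (1 : R) (fun x : R => 1 + x ^+ 2) (2 * x).
  by apply: is_derive_eq; rewrite /GRing.scale/=; ring.
have h2 := @is_derive1_comp R Num.sqrt (fun x : R => 1 + x ^+ 2) x _ _ (is_derive1_sqrt (root_gt0 x)) h1.
have h3 : is_derive x (1 : R) root (x / root x).
  by apply: is_derive_eq; rewrite -/(root x); field.
have h4 : is_derive x (1 : R) (fun t => (root t)^-1) _ := is_deriveV r0 h3.
have h5 := @is_deriveM _ _ id (fun t => (root t)^-1) x 1 _ _ (is_derive_id _ _) h4.
apply: is_derive_eq; rewrite /GRing.scale/= -/(root x).
have -> : root x ^- 3 = (root x ^+ 2 - x ^+ 2) / root x ^+ 3.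
  by rewrite r2; field.
by field.
Qed.

Lemma dvelocity_continuous : continuous (fun x : R => Num.sqrt (1 + x ^+ 2) ^- 3).
Proof.
move=> x; have [r1 _] := rootP x.
apply: (@continuous_comp _ _ _ root (fun y : R => y ^- 3)).
  apply: (@continuous_comp _ _ _ (fun x : R => 1 + x ^+ 2) Num.sqrt); last exact: sqrt_continuous.
  by apply: cvgD; [exact: cvg_cst|exact: exprn_continuous].
apply: cvgV; last exact: exprn_continuous.
by rewrite expf_neq0// gt_eqF//; lra.
Qed.

Lemma velocity_continuous : continuous velocity.
Proof. by move=> x; apply/differentiable_continuous/derivable1_diffP; case: (velocity_derive x). Qed.

(** The derivative of [velocity] lies between 0 and 1. *)
Lemma velocity_incr x y : x <= y -> 0 <= velocity y - velocity x <= y - x.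
Proof.
move=> xy.
have [c _ ->] := MVT_segment xy (fun z _ => velocity_derive z) (continuous_subspaceT velocity_continuous).
have [r1 _] := rootP c.
have h : 0 <= root c ^- 3 <= 1.
  by rewrite invr_ge0 exprn_ge0 ?invf_le1 ?exprn_gt0 ?exprn_ege1//; lra.
rewrite -/(root c); nra.
Qed.

Lemma velocity_large x : 0 <= x -> 1 - (1 + x)^-1 <= velocity x.
Proof.
move=> x0; have [r1 r2] := rootP x.
have rx : root x <= 1 + x by nra.
have -> : 1 - (1 + x)^-1 = x / (1 + x) by field; apply/eqP; lra.
by apply: ler_wpM2l => //; rewrite lef_pV2 ?posrE -/(root x)//; lra.
Qed.

Lemma velocityN x : velocity (- x) = - velocity x.
Proof. by rewrite /velocity sqrrN mulNr. Qed.

End kinetic.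

(** * Admissible functions and their action *)

Section admissible.
Context {R : realType}.
Implicit Types (u g f h c W : R -> R).

Lemma lamT_gt0 : (0 < lam R [set: R])%E.
Proof.
apply: (@lt_le_trans _ _ (lam R `]0, 1])).
  by have e := @lam_oc R 0 1 ler01; rewrite [X in (_ < X)%E]e subr0 lte_fin.
by apply: (@le_measure _ _ _ (lam R)) => //; rewrite inE//; exact: leb_itv.
Qed.

Lemma lam_aeS (P Q : R -> Prop) : (forall t, P t -> Q t) ->
  {ae lam R, forall t, P t} -> {ae lam R, forall t, Q t}.
Proof. exact: (@filterS _ _ (ae_filter_ringOfSetsType (lam R))). Qed.

Lemma lam_aeW (P : R -> Prop) : (forall t, P t) -> {ae lam R, forall t, P t}.
Proof. by move=> h; exact: (@filterE _ _ (ae_filter_ringOfSetsType (lam R))). Qed.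

Lemma Linfty_normP f (B : R) :
  (Linfty_norm f <= B%:E)%E <-> {ae lam R, forall t, `|f t| <= B}.
Proof.
rewrite /Linfty_norm unlock /Lnorm lamT_gt0; split.
  by move=> /ess_supP; apply: lam_aeS => t /=; rewrite lee_fin.
by move=> h; apply/ess_supP; move: h; apply: lam_aeS => t /=; rewrite lee_fin.
Qed.

(** The class [X1] with the derivative as part of the data. The bound on [g]
    holds everywhere, which is harmless since [g] may be changed on a null
    set. *)
Definition admissible u g := [/\ primitive u g, forall t, `|g t| <= 1, u @ -oo --> (-1 : R) & u @ +oo --> (1 : R)].

Lemma bounded_of_limits u l r : continuous u -> u @ -oo --> (l : R) -> u @ +oo --> (r : R) ->
  exists2 M, 0 <= M & forall t, `|u t| <= M.
Proof.
move=> cu ul ur.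
have [a [_ ha]] : \forall t \near -oo, `|l - u t| <= 1 by move/cvgrPdist_le : ul; exact.
have [b [_ hb]] : \forall t \near +oo, `|r - u t| <= 1 by move/cvgrPdist_le : ur; exact.
have [B hB] := (loc_bdd_continuous cu).2 (`|a| + `|b|).
exists (Num.max B (`|l| + `|r| + 1)).
  by rewrite le_max; apply/orP; right; have := normr_ge0 l; have := normr_ge0 r; lra.
move=> t; rewrite le_max; have n l' : `|l' - u t| <= 1 -> `|u t| <= `|l'| + 1.
  by move=> h; rewrite -[u t](subKr l') (le_trans (ler_normB _ _))// lerD2l.
have := normr_ge0 l; have := normr_ge0 r => r0 l0.
have [ta|at_] := ltP t a; first by apply/orP; right; have := n _ (ha _ ta); lra.
have [bt|tb] := ltP b t; first by apply/orP; right; have := n _ (hb _ bt); lra.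
apply/orP; left; apply: hB; rewrite ler_norml.
have := ler_norm b; have := ler_norm (- a); rewrite normrN; have := normr_ge0 a; have := normr_ge0 b; lra.
Qed.

Lemma admissible_bounded u g : admissible u g -> exists2 M, 0 <= M & forall t, `|u t| <= M.
Proof. by case=> ug _ ul ur; apply: bounded_of_limits ul ur; exact: primitive_continuous ug. Qed.

Lemma bounded_Linfty f B : leb_measurable f -> (forall t, `|f t| <= B) -> Lp +oo%E f.
Proof.
move=> mf fB; rewrite /Lp /= inE; apply/andP; split; first by rewrite inE.
rewrite inE /= /finite_norm; apply: (@le_lt_trans _ _ B%:E); last exact: ltry.
by apply/Linfty_normP; apply: lam_aeW.
Qed.

Lemma wderivP u g : weak_derivative u g -> weak_derivative u (wderiv u).
Proof. by move=> h; apply: (getPex (P := [set g | weak_derivative u g])); exists g. Qed.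

Lemma eq_oc_int_ae f g x y : leb_measurable f -> leb_measurable g ->
  {ae lam R, forall t, f t = g t} -> oc_int f x y = oc_int g x y.
Proof.
move=> mf mg fg; rewrite /oc_int /Rintegral; congr fine.
apply: ae_eq_integral; first exact: leb_itv.
- by apply/measurable_EFinP; exact: measurable_funS mf.
- by apply/measurable_EFinP; exact: measurable_funS mg.
- by move: fg; apply: lam_aeS => t ->.
Qed.

(** Truncating the weak derivative to [[-1, 1]] changes it on a null set only. *)
Lemma X1_admissible u : X1 u -> exists2 g, admissible u g & {ae lam R, forall t, wderiv u t = g t}.
Proof.
move=> [cu [_ [g0 wug0 _]] nu ul ur].
have wu := wderivP wug0; have [_ [mw _] _] := wu.
pose cl (x : R) : R := Num.max (-1) (Num.min 1 x).
have ccl : continuous cl.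
  move=> x; apply: (@continuous_max _ _ (fun=> -1)); first exact: cvg_cst.
  by apply: (@continuous_min _ _ (fun=> 1)); [exact: cvg_cst|exact: cvg_id].
have ae : {ae lam R, forall t, wderiv u t = cl (wderiv u t)}.
  move/Linfty_normP : nu; apply: lam_aeS => t; rewrite ler_norml => /andP[h1 h2].
  by rewrite /cl (min_idPr h2) (max_idPr h1).
have mcl : leb_measurable (fun t => cl (wderiv u t)) by exact: leb_comp.
have bcl t : `|cl (wderiv u t)| <= 1.
  by rewrite ler_norml /cl le_max lexx ge_max ge_min lexx /=; lra.
exists (fun t => cl (wderiv u t)); last exact: ae.
split=> //; split; first exact: loc_bdd_bounded bcl.
by move=> x y xy; rewrite (weak_derivative_ftc cu wu xy); exact: eq_oc_int_ae.
Qed.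

(** Both functions have the increments of [u] as integrals over intervals. *)
Lemma primitive_wderiv u g : primitive u g -> {ae lam R, forall t, wderiv u t = g t}.
Proof.
move=> ug; have wug := primitive_weak_derivative ug; have wu := wderivP wug; have cu := primitive_continuous ug.
have [_ lw _] := wu; have mw := lw.1.
have mg := ug.1.1.
have iw x y : (lam R).-integrable `]x, y] (EFin \o wderiv u) by exact: Lp_loc1_int.
have ig x y : (lam R).-integrable `]x, y] (EFin \o g) by exact: loc_bdd_integrable ug.1.
have := @ae0_of_oc_int R (fun t => wderiv u t - g t).
have h1 : leb_measurable (fun t => wderiv u t - g t) by exact: measurable_funB.
have h2 : ioc_integrable (fun t => wderiv u t - g t).
  move=> x y; rewrite [X in _.-integrable _ X](_ : _ = (EFin \o wderiv u) \- (EFin \o g))%E//.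
  by apply: integrableB => //; exact: leb_itv.
move=> /(_ h1 h2) h; suff : {ae lam R, forall t, wderiv u t - g t = 0}.
  by apply: lam_aeS => t /eqP; rewrite subr_eq0 => /eqP.
apply: h => x y xy; rewrite /oc_int RintegralB//; last exact: leb_itv.
by rewrite -!/(oc_int _ _ _) -(weak_derivative_ftc cu wu xy) (ug.2 _ _ xy) subrr.
Qed.

Lemma admissible_X1 u g : admissible u g -> X1 u.
Proof.
move=> ug; have [dug g1 ul ur] := ug; have cu := primitive_continuous dug.
have [M M0 uM] := admissible_bounded ug.
split => //.
  split; first exact: bounded_Linfty (leb_continuous cu) uM.
  exists g; first exact: primitive_weak_derivative.
  by split => //; exact: bounded_Linfty dug.1.1 g1.
by apply/Linfty_normP; move: (primitive_wderiv dug); apply: lam_aeS => t ->.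
Qed.

(** The integrand of the action, with an explicit derivative [g]. *)
Definition energy W c u g t := kinetic (g t) + c t * W (u t).

Lemma energy_measurable W c u g : leb_measurable c -> continuous W ->
  primitive u g -> leb_measurable (energy W c u g).
Proof.
move=> mc cW ug; apply: lebD.
  by apply: leb_comp; [exact: kinetic_continuous|exact: ug.1.1].
apply: lebM; [exact: mc|apply: leb_comp; first exact: cW].
by apply: leb_continuous; exact: primitive_continuous ug.
Qed.

Lemma action_admissible W c u g : leb_measurable c -> continuous W -> primitive u g ->
  lagrangian_action W c u = (\int[lam R]_t (energy W c u g t)%:E)%E.
Proof.
move=> mc cW ug; rewrite /lagrangian_action.
have [_ [mw _] _] := wderivP (primitive_weak_derivative ug).
have mwd : leb_measurable (energy W c u (wderiv u)).
  apply: lebD; first exact: leb_comp (@kinetic_continuous R) mw.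
  apply: lebM; [exact: mc|apply: leb_comp; first exact: cW].
  by apply: leb_continuous; exact: primitive_continuous ug.
apply: (@ae_eq_integral _ _ _ (lam R) setT (EFin \o energy W c u g)
  (EFin \o energy W c u (wderiv u)) measurableT (leb_EFin mwd)
  (leb_EFin (energy_measurable mc cW ug))).
by move: (primitive_wderiv ug); apply: lam_aeS => t e _; rewrite /= /energy e.
Qed.

End admissible.

(** * Cutting admissible functions at the wells *)

Section cuts.
Context {R : realType}.
Implicit Types (u g f h c W w : R -> R).

(** Modifying a function on an interval where its energy density is at most
    [K] costs at most [K] times the length. *)
Lemma integral_le_bump f1 f2 (K p q : R) : leb_measurable f1 -> leb_measurable f2 ->
  (forall t, 0 <= f1 t) -> (forall t, 0 <= f2 t) -> 0 <= K -> p <= q ->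
  (forall t, f1 t <= f2 t + (if p < t <= q then K else 0)) ->
  (\int[lam R]_t (f1 t)%:E <= \int[lam R]_t (f2 t)%:E + (K * (q - p))%:E)%E.
Proof.
move=> m1 m2 f10 f20 K0 pq h.
pose b t : R := if p < t <= q then K else 0.
have bE : b = (cst K) \_ `]p, q].
  by apply/funext => t; rewrite /b /patch mem_setE in_itv.
have mb : leb_measurable b.
  by rewrite bE; apply/(measurable_restrictT _ (leb_itv `]p, q])); exact: measurable_cst.
have b0 t : 0 <= b t by rewrite /b; case: ifP.
have -> : ((K * (q - p))%:E = \int[lam R]_t (b t)%:E)%E.
  rewrite (@integral_supported _ _ p q)//.
  - by rewrite -oc_int_cst//; congr EFin; apply: eq_oc_int => t; rewrite /b => ->.
  - apply: (@loc_bdd_integrable _ _ p q); apply: (@loc_bdd_bounded _ _ K) => // t.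
    by rewrite ger0_norm// /b; case: ifP.
  - by move=> t; rewrite /b => /negbTE ->.
rewrite -lam_intD//; apply: lam_le_int => //; exact: lebD.
Qed.

Lemma cvg_eq_ninfty u w (a l : R) : (forall t, t <= a -> w t = u t) ->
  u @ -oo --> (l : R) -> w @ -oo --> (l : R).
Proof.
move=> e; apply: cvg_trans; apply: near_eq_cvg.
by exists a; split; [exact: num_real|move=> t /ltW /e].
Qed.

Lemma cvg_eq_pinfty u w (a l : R) : (forall t, a < t -> w t = u t) ->
  u @ +oo --> (l : R) -> w @ +oo --> (l : R).
Proof.
move=> e; apply: cvg_trans; apply: near_eq_cvg.
by exists a; split; [exact: num_real|move=> t /e].
Qed.

Lemma primitive_line (k : R) : primitive (fun t => t + k) (fun=> 1).
Proof. by apply: eq_primitive (primitiveD primitive_id (primitive_cst k)) => t; rewrite ?addr0. Qed.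

(** Replace [u] on the left of [T] by a unit slope ramp descending to the well
    [-1], and by [-1] before. *)
Lemma lcut u g T : admissible u g -> -1 <= u T -> exists w h, [/\ admissible w h,
  forall t, T <= t -> w t = u t,
  forall t, T < t -> h t = g t,
  forall t, t <= T - (u T + 1) -> w t = -1 /\ h t = 0 &
  forall t, t <= T -> -1 <= w t <= u T].
Proof.
move=> [ug g1 ul ur] uT; set d := u T + 1; have d0 : 0 <= d by rewrite /d; lra.
pose ramp t : R := if t <= T - d then -1 else t + (d - T - 1).
pose ramp' t : R := if t <= T - d then 0 else 1.
have dr : primitive ramp ramp'.
  by apply: (primitive_glue (primitive_cst (-1)) (primitive_line (d - T - 1))); ring.
pose w t := if t <= T then ramp t else u t.
pose h t := if t <= T then ramp' t else g t.
have rT : ramp T = u T.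
  by rewrite /ramp; case: leP => Td; rewrite /d; [have : d = 0 by lra|]; rewrite /d; lra.
have wh : primitive w h by exact: primitive_glue.
have wl t : t <= T - d -> w t = -1 /\ h t = 0.
  by move=> td; rewrite /w /h /ramp /ramp' td (_ : t <= T)//; lra.
have wr t : T <= t -> w t = u t.
  rewrite le_eqVlt => /predU1P[<-|Tt]; first by rewrite /w lexx.
  by rewrite /w leNgt Tt.
exists w, h; split => //.
- split => //.
  + by move=> t; rewrite /h /ramp'; do ! case: ifP => _ //; rewrite ?normr0 ?normr1.
  + apply: (@cvg_eq_ninfty (fun=> -1) w (T - d)); last exact: cvg_cst.
    by move=> t /wl[].
  + by apply: (@cvg_eq_pinfty u w T) => // t /ltW /wr.
- by move=> t Tt; rewrite /h leNgt Tt.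
- by move=> t tT; rewrite /w tT /ramp; case: (leP t (T - d)) => td; rewrite /d in td *; lra.
Qed.

Lemma rcut u g T : admissible u g -> u T <= 1 -> exists w h, [/\ admissible w h,
  forall t, t <= T -> w t = u t /\ h t = g t,
  forall t, T + (1 - u T) < t -> w t = 1 /\ h t = 0 &
  forall t, T <= t -> u T <= w t <= 1].
Proof.
move=> [ug g1 ul ur] uT; set d := 1 - u T; have d0 : 0 <= d by rewrite /d; lra.
pose ramp t : R := if t <= T + d then t + (u T - T) else 1.
pose ramp' t : R := if t <= T + d then 1 else 0.
have dr : primitive ramp ramp'.
  by apply: (primitive_glue (primitive_line (u T - T)) (primitive_cst 1)); rewrite /d; ring.
pose w t := if t <= T then u t else ramp t.
pose h t := if t <= T then g t else ramp' t.
have rT : u T = ramp T.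
  by rewrite /ramp; case: leP => Td; rewrite ?/d; lra.
have wh : primitive w h by exact: primitive_glue.
have wl t : t <= T -> w t = u t /\ h t = g t by move=> td; rewrite /w /h td.
have wr t : T + d < t -> w t = 1 /\ h t = 0.
  move=> td; have Tt : T < t by lra.
  by rewrite /w /h /ramp /ramp' !leNgt td Tt.
exists w, h; split => //.
- split => //.
  + by move=> t; rewrite /h /ramp'; do ! case: ifP => _ //; rewrite ?normr0 ?normr1.
  + by apply: (@cvg_eq_ninfty u w T) => // t /wl[].
  + apply: (@cvg_eq_pinfty (fun=> 1) w (T + d)); last exact: cvg_cst.
    by move=> t /wr[].
- move=> t; rewrite le_eqVlt => /predU1P[<-|Tt]; first by rewrite /w lexx lexx.
  by rewrite /w (leNgt t T) Tt /= /ramp; case: (leP t (T + d)) => td; rewrite /d in td *; lra.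
Qed.

Lemma admissible_lip u g x y : admissible u g -> `|u y - u x| <= `|y - x|.
Proof. by move=> [ug g1 _ _]; rewrite -[leRHS]mul1r; exact: (primitive_lipT _ _ ug g1). Qed.

Section energy_of_cuts.
Variables (W c : R -> R) (C M : R).
Hypothesis cW : continuous W.
Hypothesis W0 : forall s, 0 <= W s.
Hypothesis Wm1 : W (-1) = 0.
Hypothesis W1 : W 1 = 0.
Hypothesis mc : leb_measurable c.
Hypothesis c0C : forall t, 0 <= c t <= C.
Hypothesis WM : forall s, -1 <= s <= 1 -> W s <= M.

Lemma energy_ge0 u g t : 0 <= energy W c u g t.
Proof. by rewrite addr_ge0 ?kinetic_ge0// mulr_ge0//; case/andP: (c0C t). Qed.

Lemma well_bound_ge0 : 0 <= M.
Proof. by rewrite -W1 WM//; lra. Qed.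

Lemma weight_bound_ge0 : 0 <= C.
Proof. by have := c0C 0; lra. Qed.

Lemma energy_le u g t : -1 <= u t <= 1 -> energy W c u g t <= 1 + C * M.
Proof.
move=> ut; apply: lerD; first exact: kinetic_le1.
by case/andP: (c0C t) => c0 cC; apply: ler_pM => //; exact: WM.
Qed.

Let K0 : 0 <= 1 + C * M.
Proof. by rewrite addr_ge0// mulr_ge0 ?weight_bound_ge0 ?well_bound_ge0. Qed.

Lemma lcut_energy u g T : admissible u g -> -1 <= u T <= 1 -> exists w h, [/\ admissible w h,
  forall t, T <= t -> w t = u t,
  forall t, t <= T - (u T + 1) -> w t = -1 /\ h t = 0,
  forall t, t <= T -> -1 <= w t <= u T &
  (\int[lam R]_t (energy W c w h t)%:E <=
   \int[lam R]_t (energy W c u g t)%:E + ((1 + C * M) * (u T + 1))%:E)%E].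
Proof.
move=> ug /andP[uT uT1]; have [w [h [wh e1 e2 e3 e4]]] := lcut ug uT.
exists w, h; split => //.
have -> : u T + 1 = T - (T - (u T + 1)) by ring.
apply: integral_le_bump => //; try exact: energy_ge0; try lra.
- by apply: energy_measurable => //; case: wh.
- by apply: energy_measurable => //; case: ug.
move=> t; have [tT|Tt] := leP t T; last first.
  rewrite andbF addr0 /energy e1 ?e2//; exact: ltW.
have := energy_ge0 u g t; rewrite andbT; case: (ltP (T - (u T + 1)) t) => td Eu; rewrite /= ?addr0.
  suff : energy W c w h t <= 1 + C * M by lra.
  by apply: energy_le; have := e4 _ tT; lra.
by have [wt ht] := e3 _ td; rewrite /energy wt ht kinetic0 Wm1; rewrite /energy in Eu; lra.
Qed.

Lemma rcut_energy u g T : admissible u g -> -1 <= u T <= 1 -> exists w h, [/\ admissible w h,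
  forall t, t <= T -> w t = u t,
  forall t, T + (1 - u T) < t -> w t = 1 /\ h t = 0,
  forall t, T <= t -> u T <= w t <= 1 &
  (\int[lam R]_t (energy W c w h t)%:E <=
   \int[lam R]_t (energy W c u g t)%:E + ((1 + C * M) * (1 - u T))%:E)%E].
Proof.
move=> ug /andP[uT uT1]; have [w [h [wh e1 e2 e3]]] := rcut ug uT1.
exists w, h; split => //; first by move=> t /e1[].
have -> : 1 - u T = (T + (1 - u T)) - T by ring.
apply: integral_le_bump => //; try exact: energy_ge0; try lra.
- by apply: energy_measurable => //; case: wh.
- by apply: energy_measurable => //; case: ug.
move=> t; have [tT|Tt] := leP t T.
  by rewrite addr0 /energy; have [-> ->] := e1 _ tT.
have := energy_ge0 u g t; case: (leP t (T + (1 - u T))) => td /= Eu; rewrite ?addr0.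
  suff : energy W c w h t <= 1 + C * M by lra.
  by apply: energy_le; have := e3 _ (ltW Tt); lra.
by have [wt ht] := e2 _ td; rewrite /energy wt ht kinetic0 W1; rewrite /energy in Eu; lra.
Qed.

(** Cut at the last point where [u] is at most [-1]: there [u] equals [-1], so
    the cut is free. *)
Lemma truncation_lower u g : admissible u g -> exists w h, [/\ admissible w h, forall t, -1 <= w t &
  (\int[lam R]_t (energy W c w h t)%:E <= \int[lam R]_t (energy W c u g t)%:E)%E].
Proof.
move=> ug; have [du g1 ul ur] := ug.
have lip x y := admissible_lip x y ug.
have [h|/existsNP[t0 /negP]] := pselect (forall t, -1 <= u t); first by exists u, g.
rewrite -ltNge => ut0.
pose A := [set t | u t <= -1].
have [b [_ hb]] : \forall t \near +oo, `|1 - u t| <= 1.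
  by move/cvgrPdist_le : ur; exact.
have supA : has_sup A.
  split; first by exists t0; exact: ltW.
  by exists b => t ut; rewrite leNgt; apply/negP => /hb; move: ut; rewrite /A /= ler_norml; lra.
set s := sup A.
have us : u s = -1.
  apply/eqP; rewrite eq_le; apply/andP; split; apply/ler_addgt0Pr => e e0.
    have [t At st] := sup_adherent e0 supA; rewrite -/s in st; have uA : u t <= -1 := At.
    have ts : t <= s by exact: (sup_upper_bound supA).
    by have := lip t s; rewrite (ger0_norm (_ : 0 <= s - t)) ?ler_norml; lra.
  have h : -1 < u (s + e).
    rewrite ltNge; apply/negP => h; have := sup_upper_bound supA h; rewrite -/s; lra.
  by have := lip s (s + e); rewrite (_ : s + e - s = e) ?(ger0_norm (ltW e0)) ?ler_norml; [lra|ring].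
have us1 : -1 <= u s <= 1 by rewrite us; lra.
have [w [h [wh e1 e2 e3 E]]] := lcut_energy ug us1; exists w, h; split => //.
- move=> t; have [ts|st] := leP t s; first by case/andP: (e3 _ ts).
  rewrite e1 ?ltW// ltNge; apply/negP => h'.
  by have := sup_upper_bound supA h'; rewrite -/s; lra.
- by move: E; rewrite us addNr mulr0 adde0.
Qed.

(** After [truncation_lower], cut at the first point where [u] is at least
    [1]. *)
Lemma truncation u g : admissible u g -> exists w h, [/\ admissible w h, forall t, -1 <= w t <= 1 &
  (\int[lam R]_t (energy W c w h t)%:E <= \int[lam R]_t (energy W c u g t)%:E)%E].
Proof.
move=> /truncation_lower[v [k [vk v1 E']]].
suff [w [h [wh w1 E]]] : exists w h, [/\ admissible w h, forall t, -1 <= w t <= 1 &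
  (\int[lam R]_t (energy W c w h t)%:E <= \int[lam R]_t (energy W c v k t)%:E)%E].
  by exists w, h; split => //; exact: le_trans E E'.
move: v k vk v1 {E'} => {}u {}g ug u1.
have [du g1 ul ur] := ug.
have lip x y := admissible_lip x y ug.
have [h|/existsNP[t0 /negP]] := pselect (forall t, u t <= 1).
  by exists u, g; split => // t; rewrite u1 h.
rewrite -ltNge => ut0.
pose A := [set t | 1 <= u t].
have [b [_ hb]] : \forall t \near -oo, `|-1 - u t| <= 1.
  by move/cvgrPdist_le : ul; exact.
have infA : has_inf A.
  split; first by exists t0; exact: ltW.
  by exists b => t ut; rewrite leNgt; apply/negP => /hb; move: ut; rewrite /A /= ler_norml; lra.
set s := inf A.
have us : u s = 1.
  apply/eqP; rewrite eq_le; apply/andP; split; apply/ler_addgt0Pr => e e0.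
    have h : u (s - e) < 1.
      rewrite ltNge; apply/negP => h; have := ge_inf infA.2 h; rewrite -/s; lra.
    by have := lip (s - e) s; rewrite (_ : s - (s - e) = e) ?(ger0_norm (ltW e0)) ?ler_norml; [lra|ring].
  have [t At st] := inf_adherent e0 infA; rewrite -/s in st; have uA : 1 <= u t := At.
  have ts : s <= t by exact: (ge_inf infA.2).
  by have := lip s t; rewrite (ger0_norm (_ : 0 <= t - s)) ?ler_norml; lra.
have us1 : -1 <= u s <= 1 by rewrite us; lra.
have [w [h [wh e1 e2 e3 E]]] := rcut_energy ug us1; exists w, h; split => //.
- move=> t; have [ts|st] := leP t s; last first.
    by have := e3 _ (ltW st); rewrite us; lra.
  rewrite e1// u1 /=; move: ts; rewrite le_eqVlt => /predU1P[->|ts]; first by rewrite us.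
  rewrite ltW// ltNge; apply/negP => h'.
  by have := ge_inf infA.2 h'; rewrite -/s; lra.
- by move: E; rewrite us subrr mulr0 adde0.
Qed.

(** The identity clipped to [[-1, 1]]. *)
Lemma finite_energy : exists w h, admissible w h /\ (\int[lam R]_t (energy W c w h t)%:E < +oo)%E.
Proof.
pose r1 (t : R) : R := if t <= 1 then t else 1.
pose r1' (t : R) : R := if t <= 1 then 1 else 0.
have d1 : primitive r1 r1' by exact: (primitive_glue primitive_id (primitive_cst 1)).
pose w (t : R) : R := if t <= -1 then -1 else r1 t.
pose h (t : R) : R := if t <= -1 then 0 else r1' t.
have wh : primitive w h by apply: (primitive_glue (primitive_cst (-1)) d1); rewrite /r1 ifT//; lra.
have wb t : -1 <= w t <= 1.
  by rewrite /w /r1; case: (leP t (-1)) => t1; [|case: (leP t 1) => t2]; lra.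
exists w, h; split.
  split => //.
  - by move=> t; rewrite /h /r1'; do ! case: ifP => _ //; rewrite ?normr0 ?normr1.
  - apply: (@cvg_eq_ninfty (fun=> -1) w (-1)); last exact: cvg_cst.
    by move=> t t1; rewrite /w t1.
  - apply: (@cvg_eq_pinfty (fun=> 1) w 1); last exact: cvg_cst.
    by move=> t t1; rewrite /w /r1 (leNgt t 1) t1 ifF//; apply/negbTE; lra.
apply: (@le_lt_trans _ _ (\int[lam R]_t (0 : R)%:E + ((1 + C * M) * (1 - (-1)))%:E)%E).
  apply: integral_le_bump => //; try exact: energy_ge0; try lra.
  - exact: energy_measurable.
  - exact: measurable_cst.
  move=> t; rewrite add0r; case: ifP => [_|]; first exact: energy_le.
  move=> /negbT; rewrite negb_and -!leNgt -ltNge => /orP[t1|t1].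
    by rewrite /energy /w /h t1 kinetic0 Wm1 mulr0 addr0.
  have t2 : (t <= -1) = false by apply/negbTE; lra.
  by rewrite /energy /w /h /r1 /r1' t2 (leNgt t 1) t1 kinetic0 W1 mulr0 addr0.
by rewrite integral0 add0e ltry.
Qed.

End energy_of_cuts.

End cuts.

(** * Comparison of integrals *)

Section tools.
Context {R : realType}.
Implicit Types (u g f h w : R -> R).

(** Heine's theorem, with one of the two points allowed to leave
    [[- N, N]]. *)
Lemma unif_cont h N kap : continuous h -> 0 < kap -> exists2 d, 0 < d &
  forall x y, `|x| <= N -> `|x - y| <= d -> `|h x - h y| <= kap.
Proof.
move=> ch k0.
have /compact_near_coveringP cov := @segment_compact R (- N) N.
have [] := cov R 0^'+ (fun d x => forall y, `|x - y| <= d -> `|h x - h y| <= kap) _ _.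
  move=> x _; have k2 : 0 < kap / 2 by lra.
  have := ch x; move/cvgrPdist_le => /(_ _ k2)[r /= r0 hr].
  have r2 : 0 < r / 2 by lra.
  exists (ball x (r / 2), [set d | d < r / 2]) => /=.
    split; first exact: nbhsx_ballx.
    exact: nbhs_right_lt.
  move=> [x' d] /= [xx' dr] y x'y; rewrite /ball /= in xx'.
  have h1 : `|h x - h x'| <= kap / 2 by apply: hr => /=; lra.
  have h2 : `|h x - h y| <= kap / 2.
    apply: hr => /=; have -> : x - y = (x - x') + (x' - y) by ring.
    by rewrite (le_lt_trans (ler_normD _ _))//; lra.
  have -> : h x' - h y = (h x - h y) - (h x - h x') by ring.
  by rewrite (le_trans (ler_normB _ _))//; lra.
move=> d /= d0 hd.
exists (d / 2); first by lra.
move=> x y xN; apply: (hd (d / 2)) => /=; [by rewrite sub0r normrN ger0_norm; lra|lra|].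
by rewrite in_itv/= -ler_norml.
Qed.

Lemma oc_int_le_integral f p q : loc_bdd f -> (forall t, 0 <= f t) ->
  ((oc_int f p q)%:E <= \int[lam R]_t (f t)%:E)%E.
Proof.
move=> lf f0; rewrite /oc_int /Rintegral fineK; last first.
  by apply: integrable_fin_num; [exact: leb_itv|exact: loc_bdd_integrable].
exact: (@ge0_subset_integral _ _ _ (lam R) _ _ (leb_itv `]p, q]) measurableT
  (EFin \o f) (leb_EFin lf.1) (EFin_ge0 f0) (@subsetT _ _)).
Qed.

(** Comparing two energies that agree outside [(p, q]], in a form without
    subtraction since the integrals over the line may be infinite. *)
Lemma integral_swap f1 f2 p q : loc_bdd f1 -> loc_bdd f2 ->
  (forall t, 0 <= f1 t) -> (forall t, 0 <= f2 t) ->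
  (forall t, ~~ (p < t <= q) -> f1 t = f2 t) ->
  (\int[lam R]_t (f1 t)%:E + (oc_int f2 p q)%:E =
   \int[lam R]_t (f2 t)%:E + (oc_int f1 p q)%:E)%E.
Proof.
move=> l1 l2 f10 f20 e.
pose restr f t : R := if p < t <= q then f t else 0.
have mrestr f : loc_bdd f -> (forall t, 0 <= f t) -> leb_measurable (restr f) /\
   ((oc_int f p q)%:E = \int[lam R]_t (restr f t)%:E)%E.
  move=> lf f0; have cE : restr f = f \_ `]p, q].
    by apply/funext => t; rewrite /restr /patch mem_setE in_itv.
  have mc : leb_measurable (restr f).
    by rewrite cE; apply/(measurable_restrictT _ (leb_itv `]p, q])); exact: measurable_funS lf.1.
  split => //; have lc : loc_bdd (restr f).
    split => // N; have [B hB] := lf.2 N; exists (Num.max B 0) => t tN.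
    by rewrite /restr le_max; case: ifP => _; rewrite ?hB ?normr0 ?lexx ?orbT.
  rewrite (@integral_supported _ _ p q mc (loc_bdd_integrable p q lc)).
    by congr EFin; apply: eq_oc_int => t; rewrite /restr => ->.
  by move=> t; rewrite /restr => /negbTE ->.
have c0 f : (forall t, 0 <= f t) -> forall t, 0 <= restr f t.
  by move=> f0 t; rewrite /restr; case: ifP.
have [m1 ->] := mrestr f1 l1 f10; have [m2 ->] := mrestr f2 l2 f20.
rewrite -(lam_intD measurableT l1.1 m2 f10 (c0 _ f20)).
rewrite -(lam_intD measurableT l2.1 m1 f20 (c0 _ f10)).
apply: eq_integral => t _; congr EFin; rewrite /restr.
by case: ifPn => [_|/e ->]; rewrite // addrC.
Qed.

(** Young's inequality, used in place of Cauchy-Schwarz to pass from an L^2 to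
    an L^1 bound. *)
Lemma norm_le_sq (x e : R) : 0 < e -> `|x| <= e^-1 * (x ^+ 2 / 2) + e / 2.
Proof.
move=> e0; have -> : e^-1 * (x ^+ 2 / 2) + e / 2 = `|x| + (`|x| - e) ^+ 2 / (2 * e).
  have -> : x ^+ 2 = `|x| ^+ 2 by rewrite -normrX ger0_norm// sqr_ge0.
  by field; rewrite gt_eqF.
by rewrite lerDl divr_ge0 ?sqr_ge0//; lra.
Qed.

Lemma abs_oc_int_le h (q : R -> R) x y : loc_bdd h -> loc_bdd q -> x <= y ->
  (forall t, x < t <= y -> `|h t| <= q t) -> `|oc_int h x y| <= oc_int q x y.
Proof.
move=> lh lq xy hq; rewrite ler_norml; apply/andP; split; last first.
  by apply: le_oc_int => // t /hq; rewrite ler_norml => /andP[].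
have -> : - oc_int q x y = oc_int (fun t => -1 * q t) x y by rewrite oc_intZ// mulN1r.
apply: le_oc_int => //; first exact: loc_bddZ.
by move=> t /hq; rewrite ler_norml mulN1r => /andP[].
Qed.

Lemma oc_int_widen (q : R -> R) x y x' y' : loc_bdd q -> (forall t, 0 <= q t) -> x' <= x -> x <= y -> y <= y' ->
  oc_int q x y <= oc_int q x' y'.
Proof.
move=> lq q0 h1 h2 h3.
rewrite (oc_int_cat lq h1 (le_trans h2 h3)) (oc_int_cat lq h2 h3).
have := @oc_int_ge0 _ q x' x (fun t _ => q0 t); have := @oc_int_ge0 _ q y y' (fun t _ => q0 t).
lra.
Qed.

Lemma integral_le_of_oc_int h (m : R) : loc_bdd h -> (forall t, 0 <= h t) ->
  (forall n : nat, oc_int h (- n%:R) n%:R <= m) -> (\int[lam R]_t (h t)%:E <= m%:E)%E.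
Proof.
move=> lh h0 hm.
pose Fn (n : nat) : set (lebT R) := `]- n%:R, n%:R]%classic.
have nd : {homo Fn : n k / (n <= k)%N >-> (n <= k)%O}.
  move=> n k nk; apply/subsetPset => t; rewrite /Fn /= !in_itv/= => /andP[t1 t2].
  have : n%:R <= k%:R :> R by rewrite ler_nat.
  by move=> nk'; apply/andP; split; lra.
have UF : \bigcup_n Fn n = setT.
  apply/seteqP; split => // t _.
  have [n hn] : exists n : nat, `|t| < n%:R by exists (Num.bound `|t|); apply: archi_boundP.
  by exists n => //; rewrite /Fn /= in_itv/=; move: hn; rewrite ltr_norml => /andP[->/ltW].
have mFn n : measurable (Fn n) by exact: leb_itv.
have := @ge0_nondecreasing_set_cvg_integral _ _ _ Fn (EFin \o h) (lam R) nd mFn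
  (fun n => leb_EFin lh.1) (fun n t _ => EFin_ge0 (D := setT) h0 I).
rewrite UF => cv; rewrite -(cvg_lim _ cv)//.
apply: lime_le; first by apply/cvg_ex; eexists; exact: cv.
apply: nearW => n; have := hm n; rewrite -lee_fin /oc_int /Rintegral fineK//.
by apply: integrable_fin_num; [exact: leb_itv|exact: loc_bdd_integrable].
Qed.

End tools.

(** * Limits of near-minimizers *)

Section near_minimizers.
Context {R : realType}.
Variables (W a u : R -> R) (a2 M m : R).
Hypothesis W_C1 : C1 W.
Hypothesis W0 : forall s, 0 <= W s.
Hypothesis ma : leb_measurable a.
Hypothesis a0 : forall t, 0 <= a t <= a2.
Hypothesis uM : forall t, `|u t| <= M.
Hypothesis ulip : forall x y, `|u x - u y| <= `|x - y|.
Hypothesis inf_m : forall w g, admissible w g -> (m%:E <= \int[lam R]_t (energy W a w g t)%:E)%E.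
Hypothesis approx : forall T eta : R, 0 < T -> 0 < eta -> exists w g, [/\ admissible w g,
  (\int[lam R]_t (energy W a w g t)%:E <= (m + eta)%:E)%E &
  forall t, `|t| <= T -> `|w t - u t| <= eta].

(** Linear arithmetic on the goal alone; the many inequalities in scope would
    slow it down. *)
Ltac arith := clear - W_C1 W0 ma a0 uM ulip inf_m approx; lra.

Local Notation W' := (derive1 W).
Lemma dW_continuous : continuous W'. Proof. exact: W_C1.2. Qed.
Lemma W_is_derive s : is_derive s (1 : R) W (W' s). Proof. exact: C1_is_derive. Qed.
Lemma W_continuous : continuous W. Proof. exact: primitive_continuous (C1_primitive W_C1). Qed.

Lemma lip_continuous : continuous u.
Proof.
move=> x; apply/cvgrPdist_le => e e0; exists e => // y /= xy.
by rewrite (le_trans (ulip _ _))// ltW.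
Qed.

Lemma loc_bdd_weight : loc_bdd a.
Proof.
by apply: (loc_bdd_bounded (B := a2)) => // t; case/andP: (a0 t) => h1 h2; rewrite ger0_norm.
Qed.

(** The force is frozen along the limit [u], not along the near-minimizers. *)
Definition force t := a t * W' (u t).

Lemma loc_bdd_force : loc_bdd force.
Proof.
apply: loc_bddM; first exact: loc_bdd_weight.
apply: loc_bdd_continuous => t; apply: (@continuous_comp _ _ _ u W').
  exact: lip_continuous.
exact: dW_continuous.
Qed.

Definition impulse := primitive_of force.
Lemma impulse_primitive : primitive impulse force. Proof. exact: primitive_ofP loc_bdd_force. Qed.

(** The derivatives of the extremals of the convex problem with force
    [force]. *)
Definition slope k t := velocity (impulse t + k).

Lemma slope_continuous k : continuous (slope k).
Proof.
move=> t; apply: (@continuous_comp _ _ _ (fun t => impulse t + k) (@velocity R)).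
  by apply: cvgD; [exact: (primitive_continuous impulse_primitive)|exact: cvg_cst].
exact: velocity_continuous.
Qed.

Lemma loc_bdd_slope k : loc_bdd (slope k). Proof. exact: loc_bdd_continuous (@slope_continuous k). Qed.
#[local] Hint Resolve loc_bdd_slope loc_bdd_force loc_bdd_weight : core.

Lemma slope_incr k k' t : k <= k' -> 0 <= slope k' t - slope k t <= k' - k.
Proof. by move=> kk'; rewrite /slope; have := @velocity_incr R (impulse t + k) (impulse t + k'); lra. Qed.

(** The increment over [[- T, T]] is continuous in [k] and tends to [2 T] and
    [- 2 T] as [k] tends to the two infinities. *)
Lemma slope_exists T y : 0 < T -> `|y| < 2 * T -> exists k, oc_int (slope k) (- T) T = y.
Proof.
move=> T0 yT; have TT : - T <= T by lra.
have [B hB] := (loc_bdd_continuous (primitive_continuous impulse_primitive)).2 T.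
have Bt t : - T < t <= T -> - B <= impulse t <= B.
  by move=> tT; rewrite -ler_norml; apply: hB; rewrite ler_norml; lra.
set X := 2 * T / (2 * T - `|y|).
have X0 : 0 < X by rewrite divr_gt0//; lra.
have hX : `|y| <= (1 - (1 + X)^-1) * (2 * T).
  (* X solves (1 - 1 / X) * 2 T = |y|. *)
  have hi : (1 + X)^-1 <= X^-1 by rewrite lef_pV2 ?posrE//; lra.
  have : X^-1 * (2 * T) = 2 * T - `|y| by rewrite /X; field; rewrite !gt_eqF//; lra.
  by nra.
have pX := @velocity_large R X (ltW X0).
set K := X + Num.max B 0.
have KB : B <= K - X by rewrite /K addrC addKr le_max lexx.
have psimono (x z : R) : x <= z -> velocity x <= velocity z by move=> /velocity_incr; lra.
have up : `|y| <= oc_int (slope K) (- T) T.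
  apply: (le_trans hX); have -> : 2 * T = T - - T by ring.
  rewrite -oc_int_cst//; apply: le_oc_int => //; first exact: loc_bdd_cst.
  by move=> t /Bt tB; apply: (le_trans pX); apply: psimono; lra.
have dn : oc_int (slope (- K)) (- T) T <= - `|y|.
  apply: (@le_trans _ _ (- (1 - (1 + X)^-1) * (2 * T))); last by lra.
  have -> : 2 * T = T - - T by ring.
  rewrite -oc_int_cst//; apply: le_oc_int => //; first exact: loc_bdd_cst.
  move=> t /Bt tB; apply: (@le_trans _ _ (velocity (- X))); first by apply: psimono; lra.
  by rewrite velocityN; lra.
have cI : continuous (fun k => oc_int (slope k) (- T) T).
  move=> k; apply/cvgrPdist_le => e e0; exists (e / (2 * T)) => /=; first by rewrite divr_gt0//; lra.
  move=> k' kk'; rewrite -oc_intB//.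
  have -> : e = e / (2 * T) * (T - - T) by field; rewrite gt_eqF.
  apply: oc_int_bound => //; first exact: loc_bddB.
  move=> t _; rewrite (le_trans _ (ltW kk'))//.
  have [h|/ltW h] := leP k k'; have := slope_incr t h.
    by rewrite (ler0_norm (_ : k - k' <= 0)) ?ler_norml; lra.
  by rewrite (ger0_norm (_ : 0 <= k - k')) ?ler_norml; lra.
have B0 : 0 <= Num.max B 0 by rewrite le_max lexx orbT.
have K0 : - K <= K by rewrite /K; lra.
have yy := ler_norm y; have yy' := ler_norm (- y); rewrite normrN in yy'.
have [|k _ hk] := IVT (v := y) K0 (continuous_subspaceT cI).
  by rewrite ge_min le_max; apply/andP; split; apply/orP; [left|right]; lra.
by exists k.
Qed.

Lemma loc_bdd_energy w g : primitive w g -> loc_bdd (energy W a w g).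
Proof.
move=> wg; apply: loc_bddD; last first.
  apply: loc_bddM => //; apply: loc_bdd_continuous => t.
  by apply: continuous_comp; [exact: (primitive_continuous wg)|exact: W_continuous].
apply: (loc_bdd_bounded (B := 1)); first by apply: leb_comp; [exact: kinetic_continuous|exact: wg.1.1].
by move=> t; rewrite ger0_norm ?kinetic_le1 ?kinetic_ge0.
Qed.

Lemma weighted_energy_ge0 w g t : 0 <= energy W a w g t.
Proof. by rewrite addr_ge0 ?kinetic_ge0// mulr_ge0//; case/andP: (a0 t). Qed.

(** Let [v] be the extremal with the boundary values of [w]. Comparing [w]
    with [w + s (v - w)] on [[- T, T]], convexity of [kinetic] bounds the
    integral of [kinetic g - kinetic v'] by [eta / s], plus that of
    [force * (v - w)], plus an error controlled by the oscillation [kap] of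
    [W']. By [kinetic_dual_ge] the same integral is at least the quadratic
    excess plus the integral of [(impulse + k) * (g - v')], which is also that
    of [force * (v - w)] by integration by parts: the boundary terms vanish. *)
Lemma excess_le T w g k s eta kap : 0 < T -> admissible w g ->
  (\int[lam R]_t (energy W a w g t)%:E <= (m + eta)%:E)%E ->
  oc_int (slope k) (- T) T = w T - w (- T) -> 0 < s <= 1 ->
  (forall t xi, - T <= t <= T -> `|xi - w t| <= s * (4 * T) -> `|W' xi - W' (u t)| <= kap) ->
  oc_int (fun t => (g t - slope k t) ^+ 2 / 2) (- T) T <= eta / s + a2 * (4 * T) * kap * (2 * T).
Proof.
move=> T0 wg Ew hk /andP[s0 s1] hkap; have [dw g1 wl wr] := wg.
have TT : - T <= T by lra.
pose v t := w (- T) + (primitive_of (slope k) t - primitive_of (slope k) (- T)).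
have dv : primitive v (slope k).
  apply: eq_primitive (primitiveD (primitive_cst (w (- T) - primitive_of (slope k) (- T))) (primitive_ofP (loc_bdd_slope k))) => t.
    by rewrite /v; ring.
  by rewrite add0r.
have vmT : v (- T) = w (- T) by rewrite /v subrr addr0.
have vT : v T = w T by have := dv.2 _ _ TT; rewrite hk vmT; lra.
pose z t := w t + s * (v t - w t).
pose gz t := g t + s * (slope k t - g t).
have dz : primitive z gz by exact: primitiveD dw (primitiveZ s (primitiveB dv dw)).
have p1 t : `|slope k t| <= 1 by exact/ltW/velocity_lt1.
have gz1 t : `|gz t| <= 1.
  by move: (p1 t) (g1 t); rewrite /gz !ler_norml; nra.
(* The competitor: z inside the interval, w outside. *)
pose y1 t := if t <= T then z t else w t.
pose g1' t := if t <= T then gz t else g t.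
have dy1 : primitive y1 g1' by apply: (primitive_glue dz dw); rewrite /z vT; ring.
pose y t := if t <= - T then w t else y1 t.
pose gy t := if t <= - T then g t else g1' t.
have dy : primitive y gy.
  by apply: (primitive_glue dw dy1); rewrite /y1 TT /z vmT; ring.
have yin t : - T < t <= T -> y t = z t /\ gy t = gz t.
  by move=> /andP[h1 h2]; rewrite /y /gy /y1 /g1' (leNgt t) h1 h2.
have yout t : ~~ (- T < t <= T) -> y t = w t /\ gy t = g t.
  rewrite negb_and -leNgt -ltNge /y /gy /y1 /g1' => /orP[->//|h].
  by rewrite (leNgt t T) h /= !if_same.
have ay : admissible y gy.
  split => //.
  - move=> t; have [/yin[_ ->]|/yout[_ ->]] := boolP (- T < t <= T); [exact: gz1|exact: g1].
  - by apply: (@cvg_eq_ninfty _ w y (- T)) => // t tT; apply: (yout t _).1; apply/negP; lra.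
  - by apply: (@cvg_eq_pinfty _ w y T) => // t tT; apply: (yout t _).1; rewrite negb_and -!ltNge tT orbT.
have sw := @integral_swap _ (energy W a y gy) (energy W a w g) (- T) T (loc_bdd_energy dy)
   (loc_bdd_energy dw) (weighted_energy_ge0 y gy) (weighted_energy_ge0 w g).
have {sw} : oc_int (energy W a w g) (- T) T <= eta + oc_int (energy W a y gy) (- T) T.
  rewrite -(lerD2l m) addrA -lee_fin 2!EFinD.
  apply: (@le_trans _ _ (\int[lam R]_t (energy W a y gy t)%:E + (oc_int (energy W a w g) (- T) T)%:E)%E).
    by apply: leeD => //; exact: inf_m.
  rewrite sw; last by move=> t /yout[yE gE]; rewrite /energy yE gE.
  by apply: leeD.
(* D dominates the derivative in s of the energy density of the competitor. *)
pose D t := kinetic (slope k t) - kinetic (g t) + force t * (v t - w t) + a2 * (4 * T) * kap.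
have lw : loc_bdd w by apply: loc_bdd_continuous; exact: primitive_continuous dw.
have lv : loc_bdd v by apply: loc_bdd_continuous; exact: primitive_continuous dv.
have lkin h : leb_measurable h -> loc_bdd (fun t => kinetic (h t)).
  move=> mh; apply: (loc_bdd_bounded (B := 1)); first by apply: leb_comp => //; exact: kinetic_continuous.
  by move=> t; rewrite ger0_norm ?kinetic_le1 ?kinetic_ge0.
have lD : loc_bdd D.
  apply: loc_bddD; last exact: loc_bdd_cst.
  apply: loc_bddD; last by apply: loc_bddM => //; exact: loc_bddB.
  by apply: loc_bddB; apply: lkin; [exact: (loc_bdd_slope k).1|exact: dw.1.1].
have a20 : 0 <= a2 by have := a0 0; lra.
have zeta t : - T <= t <= T -> `|v t - w t| <= 4 * T.
  move=> /andP[t1 t2].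
  have h1 := @primitive_lip _ v (slope k) 1 _ _ dv t1 (fun t _ => p1 t).
  have h2 := @primitive_lip _ w g 1 _ _ dw t1 (fun t _ => g1 t).
  have -> : v t - w t = (v t - v (- T)) - (w t - w (- T)) by rewrite vmT; ring.
  by rewrite (le_trans (ler_normB _ _))//; lra.
have ptw t : - T < t <= T -> energy W a y gy t <= energy W a w g t + s * D t.
  move=> tT; have [yE gE] := yin _ tT.
  have tT' : - T <= t <= T by lra.
  rewrite /energy yE gE /D.
  have hkin := @kinetic_convex R (g t) (slope k t) s (g1 t) (p1 t) (introT andP (conj (ltW s0) s1)).
  suff hW : a t * W (z t) <= a t * W (w t) + s * (force t * (v t - w t) + a2 * (4 * T) * kap).
    by move: hkin hW; rewrite -/(gz t); arith.
  have hz := zeta _ tT'.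
  (* Mean value theorem for W between w t and z t, in either order. *)
  have [xi xi1 Wxi] : exists2 xi, `|xi - w t| <= s * (4 * T) & W (z t) - W (w t) = W' xi * (z t - w t).
    have hzw : `|z t - w t| <= s * (4 * T).
      by rewrite /z addrC addKr normrM (ger0_norm (ltW s0)) ler_wpM2l// ltW.
    have [h|/ltW h] := leP (w t) (z t).
      have [c cin ->] := MVT_segment h (fun x _ => W_is_derive x) (continuous_subspaceT W_continuous).
      by exists c => //; move: cin hzw h; rewrite in_itv/= !ler_norml; arith.
    have [c cin hc] := MVT_segment h (fun x _ => W_is_derive x) (continuous_subspaceT W_continuous).
    by exists c; [move: cin hzw h; rewrite in_itv/= !ler_norml|move: hc]; arith.
  have hx := hkap _ _ tT' xi1.
  have -> : W (z t) = W (w t) + W' xi * (s * (v t - w t)).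
    by have -> : s * (v t - w t) = z t - w t; [rewrite /z; ring|move: Wxi; arith].
  have -> : a t * (W (w t) + W' xi * (s * (v t - w t))) =
    a t * W (w t) + s * (force t * (v t - w t)) + s * (a t * ((W' xi - W' (u t)) * (v t - w t))).
    by rewrite /force; ring.
  rewrite -addrA lerD2l -mulrDr ler_wpM2l ?(ltW s0)// lerD2l.
  have [h0 h2] := andP (a0 t).
  have hn : (W' xi - W' (u t)) * (v t - w t) <= kap * (4 * T).
    by rewrite (le_trans (ler_norm _))// normrM ler_pM.
  have kT : 0 <= kap * (4 * T) by rewrite mulr_ge0//; [exact: le_trans hx|move: T0; arith].
  rewrite -mulrA (mulrC (4 * T)).
  by apply: (@le_trans _ _ (a t * (kap * (4 * T)))); [exact: ler_wpM2l|exact: ler_wpM2r].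
move=> h1.
have h2 : oc_int (energy W a y gy) (- T) T <= oc_int (energy W a w g) (- T) T + s * oc_int D (- T) T.
  rewrite -oc_intZ// -oc_intD; [|exact: loc_bdd_energy|exact: loc_bddZ].
  by apply: le_oc_int => //; [exact: loc_bdd_energy|apply: loc_bddD; [exact: loc_bdd_energy|exact: loc_bddZ]].
have h3 : - (eta / s) <= oc_int D (- T) T.
  by rewrite -mulNr ler_pdivrMr// mulrC; move: h1 h2; arith.
have dG := primitiveD impulse_primitive (primitive_cst k).
have dprod := primitiveM dG (primitiveB dv dw).
have lq : loc_bdd (fun t => (g t - slope k t) ^+ 2 / 2).
  have lgp : loc_bdd (fun t => g t - slope k t) by apply: loc_bddB => //; exact: dw.1.
  have := loc_bddZ (2^-1) (loc_bddM lgp lgp); congr loc_bdd; apply/funext => t; rewrite expr2; ring.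
have h4 : oc_int D (- T) T <= - oc_int (fun t => (g t - slope k t) ^+ 2 / 2) (- T) T + a2 * (4 * T) * kap * (2 * T).
  have e2 : a2 * (4 * T) * kap * (2 * T) = oc_int (fun=> a2 * (4 * T) * kap) (- T) T.
    by rewrite oc_int_cst//; ring.
  have e3 := dprod.2 _ _ TT; rewrite vT vmT !subrr !mulr0 subrr in e3.
  have e1 : - oc_int (fun t => (g t - slope k t) ^+ 2 / 2) (- T) T =
    oc_int (fun t => -1 * ((g t - slope k t) ^+ 2 / 2)) (- T) T by rewrite oc_intZ// mulN1r.
  have l1 := loc_bddZ (-1) lq.
  have l2 := loc_bddD l1 dprod.1.
  rewrite e1 e2 -[oc_int (fun t => -1 * _) _ _]addr0 [X in _ + X + _]e3 -(oc_intD _ _ l1 dprod.1).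
  rewrite -(oc_intD _ _ l2 (loc_bdd_cst _)).
  apply: (le_oc_int lD (loc_bddD l2 (loc_bdd_cst _))).
  move=> t _; rewrite /D.
  have := @kinetic_dual_ge R (impulse t + k) (g t) (g1 t); rewrite -/(slope k t); arith.
by move: h3 h4; arith.
Qed.

Lemma bound_ge0 : 0 <= M. Proof. exact: le_trans (uM 0). Qed.

(** The near-minimizer [w] is L^1-close in derivative to its extremal, by
    [excess_le], and its extremal is close to the one with the boundary values
    of [u]: since [slope] is monotone in [k], the increments of the two
    extremals from [- T] differ most at [T]. *)
Lemma limit_eq T k0 : M < T -> oc_int (slope k0) (- T) T = u T - u (- T) ->
  forall t, - T <= t <= T -> u t = u (- T) + (primitive_of (slope k0) t - primitive_of (slope k0) (- T)).
Proof.
move=> MT hk0 t /andP[t1 t2].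
have T0 : 0 < T by have := bound_ge0; lra.
have TT : - T <= T by lra.
have a20 : 0 <= a2 by have := a0 0; lra.
(* Everything below depends on one small parameter e: kap, then s, then eta. *)
suff main e : 0 < e -> e <= 1 ->
    `|u t - (u (- T) + (primitive_of (slope k0) t - primitive_of (slope k0) (- T)))| <= e * (6 + T).
  apply/eqP; rewrite -subr_eq0 -normr_le0; apply/ler_addgt0Pr => e e0; rewrite add0r.
  have d0 : 0 < Num.min 1 (e / (6 + T)) by rewrite lt_min ltr01 divr_gt0//; lra.
  apply: (le_trans (main _ d0 _)); first by rewrite ge_min lexx.
  by rewrite -ler_pdivlMr ?ge_min ?lexx ?orbT//; lra.
move=> e0 e1; have ee0 : 0 < e ^+ 2 by rewrite exprn_gt0.
have A1 : 0 <= a2 * (4 * T) * (2 * T).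
  by apply: mulr_ge0; [apply: mulr_ge0|]; lra.
have A0 : 0 < a2 * (4 * T) * (2 * T) + 1 by lra.
pose kap := e ^+ 2 / 2 / (a2 * (4 * T) * (2 * T) + 1).
have kap0 : 0 < kap by rewrite !divr_gt0.
have hkap : a2 * (4 * T) * kap * (2 * T) <= e ^+ 2 / 2.
  rewrite /kap mulrAC mulrA ler_pdivrMr//; nra.
have [d d0 hd] := unif_cont M dW_continuous kap0.
pose s := Num.min 1 (d / (8 * T)).
have s01 : 0 < s <= 1 by rewrite ge_min lexx andbT lt_min ltr01 divr_gt0//; lra.
have [s0 s1] := andP s01.
have sd : s * (4 * T) <= d / 2.
  have : s * (8 * T) <= d by rewrite -ler_pdivlMr ?ge_min ?lexx ?orbT//; lra.
  by lra.
(* The last entry keeps the increment of w below 2 T. *)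
pose eta := Num.min (Num.min e (d / 2)) (Num.min (e ^+ 2 / 2 * s) ((T - M) / 2)).
have eta0 : 0 < eta.
  by rewrite !lt_min e0 /=; apply/and3P; split; [move: d0; arith|apply: mulr_gt0 => //; move: ee0; arith|move: MT; arith].
have eta1 : eta <= e by rewrite !ge_min lexx.
have eta2 : eta <= d / 2 by rewrite !ge_min lexx ?orbT.
have eta3 : eta <= e ^+ 2 / 2 * s by rewrite !ge_min lexx ?orbT.
have eta4 : eta <= (T - M) / 2 by rewrite !ge_min lexx ?orbT.
clearbody eta s kap.
have [w [g [wg Ew hw]]] := approx T0 eta0.
have [dw g1 wl wr] := wg.
have hwT : `|w T - u T| <= eta by apply: hw; rewrite ger0_norm// ltW.
have hwmT : `|w (- T) - u (- T)| <= eta by apply: hw; rewrite normrN ger0_norm// ltW.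
have [k hk] : exists k, oc_int (slope k) (- T) T = w T - w (- T).
  apply: slope_exists => //; have := uM T; have := uM (- T).
  by move: hwT hwmT eta4 MT; rewrite !ler_norml ltr_norml; arith.
have Q := @excess_le T w g k s eta kap T0 wg Ew hk s01.
have {}Q : oc_int (fun t => (g t - slope k t) ^+ 2 / 2) (- T) T <= e ^+ 2.
  apply: (@le_trans _ _ (eta / s + a2 * (4 * T) * kap * (2 * T))).
    apply: Q => r xi rT xiw; rewrite distrC; apply: hd; first exact: uM.
    have -> : u r - xi = - (w r - u r) - (xi - w r) by ring.
    rewrite (le_trans (ler_normB _ _))// normrN.
    have := hw r; rewrite ler_norml => /(_ rT); move: xiw sd eta2; arith.
  have : eta / s <= e ^+ 2 / 2 by rewrite ler_pdivrMr.
  by move: hkap; arith.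
have lgp : loc_bdd (fun t => g t - slope k t) by apply: loc_bddB => //; exact: dw.1.
have lq : loc_bdd (fun t => e^-1 * ((g t - slope k t) ^+ 2 / 2)).
  have := loc_bddZ (e^-1 / 2) (loc_bddM lgp lgp); congr loc_bdd; apply/funext => r; rewrite expr2; field.
  by rewrite gt_eqF.
have lq2 : loc_bdd (fun t => e^-1 * ((g t - slope k t) ^+ 2 / 2) + e / 2).
  by apply: loc_bddD => //; exact: loc_bdd_cst.
have lq0 : loc_bdd (fun t => (g t - slope k t) ^+ 2 / 2).
  have := loc_bddZ (2^-1) (loc_bddM lgp lgp); congr loc_bdd; apply/funext => r; rewrite expr2; ring.
have E1 : `|oc_int (fun t => g t - slope k t) (- T) t| <= e * (1 + T).
  apply: (le_trans (abs_oc_int_le lgp lq2 t1 (fun r _ => norm_le_sq _ e0))).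
  apply: (@le_trans _ _ (oc_int (fun t => e^-1 * ((g t - slope k t) ^+ 2 / 2) + e / 2) (- T) T)).
    apply: oc_int_widen => // r.
    apply: addr_ge0; last by rewrite divr_ge0// ltW.
    by apply: mulr_ge0; [rewrite invr_ge0 ltW|rewrite divr_ge0 ?sqr_ge0].
  rewrite oc_intD//; last exact: loc_bdd_cst.
  rewrite oc_intZ// oc_int_cst//.
  have : e^-1 * oc_int (fun t => (g t - slope k t) ^+ 2 / 2) (- T) T <= e by rewrite ler_pdivrMl// -expr2.
  by arith.
have E2 : `|oc_int (fun t => slope k t - slope k0 t) (- T) t| <= 2 * eta.
  have tot : `|oc_int (fun t => slope k t - slope k0 t) (- T) T| <= 2 * eta.
    rewrite oc_intB// hk hk0; have -> : w T - w (- T) - (u T - u (- T)) = (w T - u T) - (w (- T) - u (- T)) by ring.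
    by rewrite (le_trans (ler_normB _ _))//; move: hwT hwmT; arith.
  apply: (le_trans _ tot); have [kk|/ltW kk] := leP k0 k.
    have pos r : 0 <= slope k r - slope k0 r by case/andP: (slope_incr r kk).
    by rewrite !ger0_norm ?oc_int_ge0//; apply: oc_int_widen => //; exact: loc_bddB.
  have pos r : 0 <= slope k0 r - slope k r by case/andP: (slope_incr r kk).
  have sw y : oc_int (fun t => slope k t - slope k0 t) (- T) y = - oc_int (fun t => slope k0 t - slope k t) (- T) y.
    by rewrite !oc_intB// opprB.
  by rewrite !sw !normrN !ger0_norm ?oc_int_ge0//; apply: oc_int_widen => //; exact: loc_bddB.
have E3 : `|w t - u t| <= eta by apply: hw; rewrite ler_norml t1.
have -> : u t - (u (- T) + (primitive_of (slope k0) t - primitive_of (slope k0) (- T))) =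
  oc_int (fun t => g t - slope k t) (- T) t + (w (- T) - u (- T)) + oc_int (fun t => slope k t - slope k0 t) (- T) t
  - (w t - u t).
  rewrite oc_intB//; last exact: dw.1.
  rewrite -(dw.2 _ _ t1) oc_intB// -[oc_int (slope k0) _ _]((primitive_ofP (loc_bdd_slope k0)).2 _ _ t1); ring.
rewrite (le_trans (ler_normB _ _))//.
have := ler_normD (oc_int (fun t => g t - slope k t) (- T) t + (w (- T) - u (- T))) (oc_int (fun t => slope k t - slope k0 t) (- T) t).
have := ler_normD (oc_int (fun t => g t - slope k t) (- T) t) (w (- T) - u (- T)).
by move: e0 E1 E2 E3 hwmT eta1; arith.
Qed.

(** The supporting lines of [kinetic] along the limit give a lower bound for
    the energy of [w] up to the integral of [(impulse + k0) * (g - slope k0)],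
    which is small after an integration by parts. *)
Lemma limit_energy T k0 : M < T -> oc_int (slope k0) (- T) T = u T - u (- T) ->
  oc_int (energy W a u (slope k0)) (- T) T <= m.
Proof.
move=> MT hk0; have uV := limit_eq MT hk0.
have T0 : 0 < T by have := bound_ge0; lra.
have TT : - T <= T by lra.
have a20 : 0 <= a2 by have := a0 0; lra.
pose V t := u (- T) + (primitive_of (slope k0) t - primitive_of (slope k0) (- T)).
have dV : primitive V (slope k0).
  apply: eq_primitive (primitiveD (primitive_cst (u (- T) - primitive_of (slope k0) (- T))) (primitive_ofP (loc_bdd_slope k0))) => t.
    by rewrite /V; ring.
  by rewrite add0r.
have -> : oc_int (energy W a u (slope k0)) (- T) T = oc_int (energy W a V (slope k0)) (- T) T.
  by apply: eq_oc_int => t tT; rewrite /energy /V -uV//; lra.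
have dG := primitiveD impulse_primitive (primitive_cst k0).
have [C hC] := (loc_bdd_continuous (primitive_continuous dG)).2 T.
have C0 : 0 <= C by apply: le_trans (hC 0 _) => //; rewrite normr0 ltW.
have [B hB] := loc_bdd_force.2 T.
have B0 : 0 <= B by apply: le_trans (hB 0 _) => //; rewrite normr0 ltW.
apply/ler_addgt0Pr => e e0.
have A1 : 0 <= 2 * T * a2 by rewrite mulr_ge0//; lra.
have A2 : 0 <= 2 * C + B * (2 * T) by rewrite addr_ge0 ?mulr_ge0//; lra.
pose kap := e / 2 / (2 * T * a2 + 1).
have kap0 : 0 < kap by rewrite !divr_gt0//; lra.
have hkap : a2 * kap * (2 * T) <= e / 2.
  rewrite /kap [a2 * _]mulrC mulrAC mulrAC -mulrA mulrAC ler_pdivrMr; last by lra.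
  nra.
have [d d0 hd] := unif_cont M W_continuous kap0.
pose eta := Num.min d (e / 2 / (1 + (2 * C + B * (2 * T)))).
have eta0 : 0 < eta by rewrite lt_min d0 /= !divr_gt0//; lra.
have eta1 : eta <= d by rewrite ge_min lexx.
have eta2 : eta * (1 + (2 * C + B * (2 * T))) <= e / 2.
  by rewrite -ler_pdivlMr ?ge_min ?lexx ?orbT//; lra.
clearbody eta kap.
have [w [g [wg Ew hw]]] := approx T0 eta0.
have [dw g1 wl wr] := wg.
have hE : oc_int (energy W a w g) (- T) T <= m + eta.
  by rewrite -lee_fin; apply: le_trans Ew; apply: oc_int_le_integral; [exact: loc_bdd_energy|exact: weighted_energy_ge0].
have dprod := primitiveM dG (primitiveB dw dV).
have e3 := dprod.2 _ _ TT.
have VmT : V (- T) = u (- T) by rewrite /V; ring.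
have VT : V T = u T by rewrite /V -uV// TT lexx.
have hC1 : `|impulse T + k0| <= C by apply: hC; rewrite ger0_norm// ltW.
have hC2 : `|impulse (- T) + k0| <= C by apply: hC; rewrite normrN ger0_norm// ltW.
have hu1 : `|w T - V T| <= eta by rewrite VT; apply: hw; rewrite ger0_norm// ltW.
have hu2 : `|w (- T) - V (- T)| <= eta by rewrite VmT; apply: hw; rewrite normrN ger0_norm// ltW.
have bd : - (2 * C * eta) <= (impulse T + k0) * (w T - V T) - (impulse (- T) + k0) * (w (- T) - V (- T)).
  have b1 : `|(impulse T + k0) * (w T - V T)| <= C * eta by rewrite normrM ler_pM.
  have b2 : `|(impulse (- T) + k0) * (w (- T) - V (- T))| <= C * eta by rewrite normrM ler_pM.
  by move: b1 b2; rewrite !ler_norml; arith.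
have lc : loc_bdd (fun=> B * eta + a2 * kap) by exact: loc_bdd_cst.
have lE := loc_bdd_energy dw.
have l1 := loc_bddB lE dprod.1.
have l2 := loc_bddD l1 lc.
have : oc_int (energy W a V (slope k0)) (- T) T <= oc_int (energy W a w g) (- T) T -
   oc_int (fun t => (force t + 0) * (w t - V t) + (impulse t + k0) * (g t - slope k0 t)) (- T) T
   + (B * eta + a2 * kap) * (2 * T).
  have -> : 2 * T = T - - T by ring.
  rewrite -oc_int_cst// -(oc_intB _ _ lE dprod.1) -(oc_intD _ _ l1 lc).
  apply: (le_oc_int (loc_bdd_energy dV) l2) => t tT.
  have tT' : - T <= t <= T by case/andP: tT => /ltW -> ->.
  have tT2 : `|t| <= T by rewrite ler_norml.
  have h1 := @kinetic_dual_ge R (impulse t + k0) (g t) (g1 t); rewrite -/(slope k0 t) in h1.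
  have h2 := sqr_ge0 (g t - slope k0 t).
  have uVt : V t = u t by rewrite /V -uV.
  have h3 : `|force t * (w t - V t)| <= B * eta by rewrite normrM uVt ler_pM// ?hB ?hw.
  have h4 : `|a t * (W (V t) - W (w t))| <= a2 * kap.
    have [ap a2b] := andP (a0 t).
    rewrite normrM (ger0_norm ap) ler_pM// uVt; apply: hd; first exact: uM.
    by rewrite distrC (le_trans (hw _ tT2)).
  by rewrite /energy addr0; move: h1 h2 h3 h4; rewrite !ler_norml; arith.
by rewrite -e3; move: hE bd eta2 hkap; arith.
Qed.

(** The Euler-Lagrange equation on [[- T, T]] in integrated form, for the
    momentum [G]. *)
Lemma near_min_limit T : M < T -> exists G, [/\ primitive G (fun t => a t * W' (u t)),
  forall x y, - T <= x -> x <= y -> y <= T -> u y - u x = oc_int (fun s => velocity (G s)) x y &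
  oc_int (energy W a u (fun s => velocity (G s))) (- T) T <= m].
Proof.
move=> MT; have T0 : 0 < T by have := bound_ge0; lra.
have [|k hk] := @slope_exists T (u T - u (- T)) T0.
  by have := uM T; have := uM (- T); rewrite !ler_norml ltr_norml; lra.
exists (fun t => impulse t + k); split.
- by apply: eq_primitive (primitiveD impulse_primitive (primitive_cst k)) => // t; rewrite addr0.
- move=> x y Tx xy yT; rewrite (@limit_eq _ _ MT hk x) ?(@limit_eq _ _ MT hk y); try lra.
  by have := (primitive_ofP (loc_bdd_slope k)).2 _ _ xy; rewrite -/(slope k) => <-; ring.
- exact: limit_energy.
Qed.

End near_minimizers.

(** * Behaviour at infinity *)

Section asymptotics.
Context {R : realType}.
Implicit Types (u g h H W : R -> R).

Lemma velocity_lip (x y : R) : `|velocity x - velocity y| <= `|x - y|.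
Proof.
have wlo (s t : R) : s <= t -> `|velocity t - velocity s| <= `|t - s|.
  by move=> st; have /andP[h1 h2] := velocity_incr st; rewrite !ger0_norm//; exact: le_trans h2.
by have [xy|/ltW yx] := leP x y; [rewrite distrC (distrC x)|]; exact: wlo.
Qed.

Let inc H h (L eta t : R) : primitive H h -> (forall x y, `|h x - h y| <= L * `|x - y|) ->
  0 <= L -> 0 < eta ->
  `|h t| * eta <= `|H (t + eta) - H t| + L * eta ^+ 2 /\
  `|h t| * eta <= `|H t - H (t - eta)| + L * eta ^+ 2.
Proof.
move=> dH hL L0 eta0.
have one x y : x <= t <= y -> y - x = eta -> `|h t| * eta <= `|H y - H x| + L * eta ^+ 2.
  move=> /andP[xt ty] yx; have xy : x <= y by lra.
  have -> : `|h t| * eta = `|oc_int (fun=> h t) x y| by rewrite oc_int_cst// yx normrM (gtr0_norm eta0).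
  have -> : oc_int (fun=> h t) x y = (H y - H x) + oc_int (fun s => h t - h s) x y.
    by rewrite oc_intB ?(dH.2 _ _ xy)//; [ring|exact: loc_bdd_cst|exact: dH.1].
  rewrite (le_trans (ler_normD _ _))// lerD2l expr2 mulrA -{2}yx.
  apply: oc_int_bound => //; first by apply: loc_bddB; [exact: loc_bdd_cst|exact: dH.1].
  move=> s /andP[xs sy]; rewrite (le_trans (hL _ _))// ler_wpM2l// ler_norml; lra.
by split; apply: one; lra.
Qed.

(** Barbalat: a value [h t] forces an increment [h t * eta] of the primitive up
    to [L * eta ^ 2]. *)
Lemma barbalat_pinfty H h L l : primitive H h -> (forall x y, `|h x - h y| <= L * `|x - y|) ->
  H @ +oo --> (l : R) -> h @ +oo --> (0 : R).
Proof.
move=> dH hL Hl; apply/cvgrPdist_le => e e0.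
have L0 : 0 <= L by have := hL 0 1; rewrite sub0r normrN normr1 mulr1; exact: le_trans.
pose eta := e / (2 * (L + 1)).
have eta0 : 0 < eta by rewrite divr_gt0//; lra.
have Leta : L * eta <= e / 2.
  by rewrite /eta mulrA ler_pdivrMr; [nra|lra].
have d0 : 0 < e * eta / 4 by have := mulr_gt0 e0 eta0; lra.
move/cvgrPdist_le : Hl => /(_ _ d0)[A [_ hA]].
exists A; split; first exact: num_real.
move=> t At; rewrite sub0r normrN.
have [h1 _] := @inc H h L eta t dH hL L0 eta0.
have h2 := hA _ At; have h3 : `|l - H (t + eta)| <= e * eta / 4 by apply: hA; lra.
have h4 : `|H (t + eta) - H t| <= e * eta / 2.
  have -> : H (t + eta) - H t = (l - H t) - (l - H (t + eta)) by ring.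
  by rewrite (le_trans (ler_normB _ _))//; lra.
rewrite -(ler_pM2r eta0); have := ler_wpM2r (ltW eta0) Leta; rewrite expr2 in h1; lra.
Qed.

Lemma barbalat_ninfty H h L l : primitive H h -> (forall x y, `|h x - h y| <= L * `|x - y|) ->
  H @ -oo --> (l : R) -> h @ -oo --> (0 : R).
Proof.
move=> dH hL Hl; apply/cvgrPdist_le => e e0.
have L0 : 0 <= L by have := hL 0 1; rewrite sub0r normrN normr1 mulr1; exact: le_trans.
pose eta := e / (2 * (L + 1)).
have eta0 : 0 < eta by rewrite divr_gt0//; lra.
have Leta : L * eta <= e / 2.
  by rewrite /eta mulrA ler_pdivrMr; [nra|lra].
have d0 : 0 < e * eta / 4 by have := mulr_gt0 e0 eta0; lra.
move/cvgrPdist_le : Hl => /(_ _ d0)[A [_ hA]].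
exists A; split; first exact: num_real.
move=> t At; rewrite sub0r normrN.
have [_ h1] := @inc H h L eta t dH hL L0 eta0.
have h2 := hA _ At; have h3 : `|l - H (t - eta)| <= e * eta / 4 by apply: hA; lra.
have h4 : `|H t - H (t - eta)| <= e * eta / 2.
  have -> : H t - H (t - eta) = (l - H (t - eta)) - (l - H t) by ring.
  by rewrite (le_trans (ler_normB _ _))//; lra.
rewrite -(ler_pM2r eta0); have := ler_wpM2r (ltW eta0) Leta; rewrite expr2 in h1; lra.
Qed.

(** The primitive is monotone and bounded, so it converges at both ends, and
    Barbalat's lemma applies. *)
Lemma oc_int_bounded_vanish h L B : loc_bdd h -> (forall t, 0 <= h t) ->
  (forall x y, `|h x - h y| <= L * `|x - y|) ->
  (forall x y, x <= y -> oc_int h x y <= B) ->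
  h @ -oo --> (0 : R) /\ h @ +oo --> (0 : R).
Proof.
move=> lh h0 hL hB; have dH := primitive_ofP lh; set H := primitive_of h in dH.
have nd x y : x <= y -> H x <= H y.
  by move=> xy; rewrite -subr_ge0 (dH.2 _ _ xy); apply: oc_int_ge0.
have p0 : H 0 = 0.
  by rewrite /H /primitive_of lexx; have := oc_int_cat lh (lexx 0) (lexx 0); lra.
have B0 : 0 <= B by apply: le_trans (hB 0 0 _) => //; exact: oc_int_ge0.
have bd x : - B <= H x <= B.
  have [x0|/ltW x0] := leP 0 x.
    by have := hB _ _ x0; rewrite -(dH.2 _ _ x0) p0; have := nd _ _ x0; rewrite p0; lra.
  by have := hB _ _ x0; rewrite -(dH.2 _ _ x0) p0; have := nd _ _ x0; rewrite p0; lra.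
split.
- apply: (@barbalat_ninfty H h L (inf (range H))) => //.
  have hi : has_inf (range H).
    by split; [exists (H 0), 0|exists (- B) => _ [x _ <-]; case/andP: (bd x)].
  apply/cvgrPdist_le => e e0.
  have [_ [A _ <-] hA] := inf_adherent e0 hi.
  exists A; split; first exact: num_real.
  move=> t /ltW/nd tA; have : inf (range H) <= H t by apply: ge_inf; [exact: hi.2|exists t].
  by move=> it; rewrite ler_norml; lra.
- apply: (@barbalat_pinfty H h L (sup (range H))) => //.
  apply: nondecreasing_cvgr => //.
  by exists B => _ [x _ <-]; case/andP: (bd x).
Qed.

Lemma pos_lower_bound W (p q : R) : continuous W -> (forall s, p <= s <= q -> 0 < W s) ->
  exists2 c, 0 < c & forall s, p <= s <= q -> c <= W s.
Proof.
move=> cW Wpos; have [pq|qp] := leP p q; last by exists 1 => // s; lra.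
have [c cin hc] := EVT_min pq (continuous_subspaceT cW).
exists (W c); first by apply: Wpos; move: cin; rewrite in_itv.
by move=> s sin; apply: hc; rewrite in_itv.
Qed.

Lemma C1_lip W N : C1 W -> exists2 L, 0 <= L &
  (forall s, `|s| <= N -> `|derive1 W s| <= L) /\
  forall x y, `|x| <= N -> `|y| <= N -> `|W x - W y| <= L * `|x - y|.
Proof.
move=> cW; have [B hB] := (loc_bdd_continuous cW.2).2 N.
exists (Num.max B 0); first by rewrite le_max lexx orbT.
split; first by move=> s /hB h; rewrite le_max h.
have ww : forall x y : R, x <= y -> `|x| <= N -> `|y| <= N -> `|W y - W x| <= Num.max B 0 * `|y - x|.
  move=> x y xy xN yN.
  have [c cin ->] := MVT_segment xy (fun z _ => C1_is_derive cW z)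
    (continuous_subspaceT (primitive_continuous (C1_primitive cW))).
  rewrite normrM ler_wpM2r// le_max hB//; move: cin xN yN; rewrite in_itv/= !ler_norml; lra.
move=> x y xN yN; have [xy|/ltW yx] := leP x y; last exact: ww.
by rewrite distrC (distrC x); exact: ww.
Qed.

End asymptotics.

(** * Regularity of the limit *)

Section regularity.
Context {R : realType}.
Variables (W a u : R -> R) (a1 a2 M m : R).
Hypothesis W_C1 : C1 W.
Hypothesis W0 : forall s, 0 <= W s.
Hypothesis ma : leb_measurable a.
Hypothesis a1_gt0 : 0 < a1.
Hypothesis a12 : forall t, a1 <= a t <= a2.
Hypothesis uM : forall t, `|u t| <= M.
Hypothesis hcore : forall T, M < T -> exists G, [/\ primitive G (fun t => a t * derive1 W (u t)),
  forall x y, - T <= x -> x <= y -> y <= T -> u y - u x = oc_int (fun s => velocity (G s)) x y &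
  oc_int (energy W a u (fun s => velocity (G s))) (- T) T <= m].

(** The conjugate variable of [u], whose derivative is the force in the
    Euler-Lagrange equation. *)
Definition momentum t := derive1 u t / Num.sqrt (1 - `|derive1 u t| ^+ 2).

Let continuous_velocity (G : R -> R) : continuous G -> continuous (fun t => velocity (G t)).
Proof.
move=> cG t; apply: (@continuous_comp _ _ _ G (@velocity R)); first exact: cG.
exact: velocity_continuous.
Qed.

Let local T : M < T -> exists G, [/\ primitive G (fun t => a t * derive1 W (u t)),
  forall t, - T < t < T -> is_derive t (1 : R) u (velocity (G t)),
  forall t, - T < t < T -> momentum t = G t &
  oc_int (energy W a u (fun s => velocity (G s))) (- T) T <= m].
Proof.
move=> MT; have [G [dG hG hE]] := hcore MT; exists G.
have cG := continuous_velocity (primitive_continuous dG).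
have der t : - T < t < T -> is_derive t (1 : R) u (velocity (G t)).
  move=> tT; apply: (@derive_of_oc_int _ u (fun t => velocity (G t)) t (T - `|t|)).
  - by rewrite subr_gt0 ltr_norml.
  - exact: loc_bdd_continuous.
  - move=> lo hi lohi h1 h2.
    have nr s : `|s - t| < T - `|t| -> - T <= s <= T.
      move=> st; rewrite -ler_norml; have := ler_normD (s - t) t; rewrite subrK; lra.
    have := nr _ h1; have := nr _ h2 => /andP[_ ?] /andP[? _]; exact: hG.
  - exact: cG.
split => // t tT; rewrite /momentum (is_derive_derive1 (der t tT)); exact: velocityK.
Qed.

Let bigT (x : R) : M < `|M| + 1 + `|x|.
Proof. by have := ler_norm M; have := normr_ge0 x; lra. Qed.

Let inT (x : R) t : `|t| <= `|x| -> - (`|M| + 1 + `|x|) < t < `|M| + 1 + `|x|.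
Proof. by move=> h; rewrite -ltr_norml; have := normr_ge0 M; lra. Qed.

(** On each interval the momentum is the function [G] given by [hcore],
    because [velocity] can be inverted. *)
Lemma momentum_primitive : primitive momentum (fun t => a t * derive1 W (u t)).
Proof.
split; first by have [G [[]]] := local (bigT 0).
move=> x y xy.
have [G [dG _ hG _]] := local (bigT (Num.max `|x| `|y|)).
have n0 : 0 <= Num.max `|x| `|y| by rewrite le_max normr_ge0.
rewrite !hG ?(dG.2 _ _ xy)//; apply: inT; rewrite (ger0_norm n0) le_max lexx ?orbT//.
Qed.

Lemma derive1_velocity t : derive1 u t = velocity (momentum t) /\ derivable u t 1.
Proof.
have [G [dG hd hG _]] := local (bigT t); have tT := inT (lexx `|t|).
by have d := hd _ tT; rewrite (is_derive_derive1 d) hG//; split => //; case: d.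
Qed.

Lemma u_C1 : C1 u.
Proof.
split=> [t|]; first exact: (derive1_velocity t).2.
have -> : derive1 u = fun t => velocity (momentum t) by apply/funext => t; exact: (derive1_velocity t).1.
exact: continuous_velocity (primitive_continuous momentum_primitive).
Qed.

Lemma du_lt1 t : `|derive1 u t| < 1.
Proof. by rewrite (derive1_velocity t).1; exact: velocity_lt1. Qed.

Let du := C1_primitive u_C1.

Lemma u_energy : (\int[lam R]_t (energy W a u (derive1 u) t)%:E <= m%:E)%E.
Proof.
have a0 t : 0 <= a t by have := a12 t; have := a1_gt0; lra.
have E0 g t : 0 <= energy W a u g t by rewrite addr_ge0 ?kinetic_ge0// mulr_ge0.
have la : loc_bdd a.
  by apply: (loc_bdd_bounded (B := a2)) => // t; have := a12 t; have := a0 t; rewrite ler_norml; lra.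
have lE g : leb_measurable g -> loc_bdd (energy W a u g).
  move=> mg; apply: loc_bddD; last first.
    apply: loc_bddM => //; apply: loc_bdd_continuous => t.
    apply: continuous_comp; first exact: (primitive_continuous du).
    exact: (primitive_continuous (C1_primitive W_C1)).
  apply: (loc_bdd_bounded (B := 1)); first by apply: leb_comp => //; exact: kinetic_continuous.
  by move=> t; rewrite ger0_norm ?kinetic_le1 ?kinetic_ge0.
apply: integral_le_of_oc_int => //; first exact: lE du.1.1.
move=> n; have [G [dG hd hG hE]] := local (bigT n%:R).
apply: le_trans hE.
have n0 : 0 <= n%:R :> R by [].
rewrite (@eq_oc_int _ _ (energy W a u (fun s => velocity (G s)))); last first.
  move=> t tn; rewrite /energy (derive1_velocity t).1 hG//; apply: inT.
  by rewrite (ger0_norm n0) ler_norml; lra.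
have M0 := normr_ge0 M.
apply: oc_int_widen => //; try (rewrite (ger0_norm n0); lra); last by lra.
by apply: lE; apply: leb_continuous; exact: continuous_velocity (primitive_continuous dG).
Qed.

(** [W o u] is Lipschitz, and its integral is at most that of the energy
    divided by [a1]. *)
Lemma W_vanish : (fun t => W (u t)) @ -oo --> (0 : R) /\ (fun t => W (u t)) @ +oo --> (0 : R).
Proof.
have [L L0 [_ hL]] := C1_lip M W_C1.
have lWu : loc_bdd (fun t => W (u t)).
  apply: loc_bdd_continuous => t; apply: continuous_comp; first exact: (primitive_continuous du).
  exact: (primitive_continuous (C1_primitive W_C1)).
apply: (@oc_int_bounded_vanish _ _ L (m / a1)) => //.
  move=> x y; apply: le_trans (hL _ _ (uM x) (uM y)) _; rewrite ler_wpM2l//.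
  by rewrite -[leRHS]mul1r; apply: (primitive_lipT _ _ du) => t; exact/ltW/du_lt1.
move=> x y xy; rewrite ler_pdivlMr// mulrC -oc_intZ//.
have E0 t : 0 <= energy W a u (derive1 u) t.
  by rewrite addr_ge0 ?kinetic_ge0// mulr_ge0//; have := a12 t; have := a1_gt0; lra.
have lE : loc_bdd (energy W a u (derive1 u)).
  have la : loc_bdd a.
    by apply: (loc_bdd_bounded (B := a2)) => // t; have := a12 t; have := a1_gt0; rewrite ler_norml; lra.
  apply: loc_bddD; last exact: loc_bddM.
  apply: (loc_bdd_bounded (B := 1)); last by move=> t; rewrite ger0_norm ?kinetic_le1 ?kinetic_ge0.
  by apply: leb_comp; [exact: kinetic_continuous|exact: du.1.1].
rewrite -lee_fin; apply: le_trans u_energy; apply: le_trans (oc_int_le_integral x y lE E0).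
rewrite lee_fin; apply: le_oc_int => //; first exact: loc_bddZ.
move=> t _; rewrite /energy; have := kinetic_ge0 (derive1 u t); have := ler_wpM2r (W0 (u t)) (andP (a12 t)).1.
lra.
Qed.

Hypothesis ul : u @ -oo --> (-1 : R).
Hypothesis ur : u @ +oo --> (1 : R).

Lemma u_admissible : admissible u (derive1 u).
Proof. by split => // t; exact/ltW/du_lt1. Qed.

Let mom_lip : exists L, forall x y, `|derive1 u x - derive1 u y| <= L * `|x - y|.
Proof.
have [L L0 [hL _]] := C1_lip M W_C1.
exists (a2 * L) => x y; rewrite !(derive1_velocity _).1.
apply: (le_trans (velocity_lip _ _)); apply: (primitive_lipT _ _ momentum_primitive) => t.
rewrite normrM ler_pM// ?hL//; have := a12 t; have := a1_gt0; rewrite ler_norml; lra.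
Qed.

(** [u'] is Lipschitz, as the velocity of a Lipschitz momentum, and its
    primitive [u] converges. *)
Lemma du_limits : derive1 u @ -oo --> (0 : R) /\ derive1 u @ +oo --> (0 : R).
Proof.
have [L hL] := mom_lip; split.
- exact: (barbalat_ninfty du hL ul).
- exact: (barbalat_pinfty du hL ur).
Qed.

Lemma du_norm : (Linfty_norm (derive1 u) < 1)%E.
Proof.
have [dl dr] := du_limits.
have h2 : 0 < 2^-1 :> R by rewrite invr_gt0.
move/cvgrPdist_le : dl => /(_ _ h2)[A [_ hA]].
move/cvgrPdist_le : dr => /(_ _ h2)[B [_ hB]].
pose N := `|A| + `|B|; have N0 : 0 <= N by rewrite addr_ge0.
have cn : {within `[- N, N], continuous (fun t => `|derive1 u t|)}.
  apply: continuous_subspaceT => t; apply: continuous_comp; first exact: u_C1.2.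
  exact: norm_continuous.
have [|c _ hc] := EVT_max _ cn; first by lra.
pose r := Num.max 2^-1 `|derive1 u c|.
apply: (@le_lt_trans _ _ r%:E); last by rewrite lte_fin gt_max du_lt1 invf_lt1 ?ltr1n.
apply/Linfty_normP; apply: lam_aeW => t; rewrite le_max.
have [tA|At] := ltP t A; first by have := hA _ tA; rewrite sub0r normrN => ->.
have [Bt|tB] := ltP B t; first by have := hB _ Bt; rewrite sub0r normrN => ->.
apply/orP; right; apply: hc; rewrite in_itv/= /N.
have := ler_norm (- A); have := ler_norm B; rewrite normrN; have := normr_ge0 A; have := normr_ge0 B; lra.
Qed.

Lemma conclusion : [/\ C1 u, W22_loc u,
  weak_derivative momentum (fun t => a t * derive1 W (u t)),
  [/\ (u t, derive1 u t) @[t --> -oo] --> (-1 : R, 0 : R) &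
      (u t, derive1 u t) @[t --> +oo] --> (1 : R, 0 : R)] &
  (Linfty_norm (derive1 u) < 1)%E].
Proof.
have [dl dr] := du_limits; split.
- exact: u_C1.
- have two : 1 <= 2 :> R by rewrite ler1n.
  split; first by apply: loc_bdd_Lp_loc => //; apply: loc_bdd_continuous; exact: primitive_continuous du.
  exists (derive1 u); first exact: primitive_weak_derivative.
  split; first by apply: loc_bdd_Lp_loc => //; exact: du.1.
  have d2 := primitive_comp (@velocity_derive R) (@dvelocity_continuous R) momentum_primitive.
  have E : (fun t => velocity (momentum t)) = derive1 u by apply/funext => t; rewrite (derive1_velocity t).1.
  rewrite E in d2; eexists; first exact: primitive_weak_derivative d2.
  by split => //; apply: loc_bdd_Lp_loc => //; exact: d2.1.
- exact: primitive_weak_derivative momentum_primitive.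
- by split; [exact: cvg_pair ul dl|exact: cvg_pair ur dr].
- exact: du_norm.
Qed.

End regularity.

(** * Compactness and confinement of the transition *)

Section compactness.
Context {R : realType}.
Implicit Types (u w g W a b : R -> R).

(** Arzela-Ascoli without subsequences: an ultrafilter finer than the family
    converges at every point, and a finite net turns pointwise into uniform
    convergence on [[- T, T]]. The index [eta] plays the role of the tail of a
    minimizing sequence. *)
Lemma lip_compact (K : R -> set (R -> R)) :
  (forall eta, 0 < eta -> K eta !=set0) ->
  (forall eta eta', eta <= eta' -> K eta `<=` K eta') ->
  (forall eta w, K eta w -> forall t, -1 <= w t <= 1) ->
  (forall eta w, K eta w -> forall x y, `|w x - w y| <= `|x - y|) ->
  exists u, [/\ forall t, -1 <= u t <= 1, forall x y, `|u x - u y| <= `|x - y| &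
    forall T eta, 0 < T -> 0 < eta -> exists2 w, K eta w & forall t, `|t| <= T -> `|w t - u t| <= eta].
Proof.
move=> K0 Kmono K1 Klip.
have FF : Filter (filter_from [set eta | 0 < eta] K).
  apply: filter_from_filter; first by exists 1 => /=.
  move=> i j /= i0 j0; exists (Num.min i j); first by rewrite /= lt_min i0.
  by move=> w Kw; split; apply: Kmono Kw; rewrite ge_min lexx ?orbT.
have PF : ProperFilter (filter_from [set eta | 0 < eta] K) by apply: filter_from_proper.
have [G [UG FG]] := ultraFilterLemma PF.
have PG : ProperFilter G by exact: ultra_proper.
have GF : Filter G by exact: filter_filter.
have GK eta : 0 < eta -> G (K eta) by move=> e0; apply: FG; exists eta.
have lims t : exists2 l : R, -1 <= l <= 1 & (fun w : R -> R => w t) @ G --> l.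
  have Gt : G ((fun w : R -> R => w t) @^-1` `[-1, 1]).
    by apply: filterS (GK 1 ltr01) => w Kw; rewrite /= in_itv/=; exact: K1 Kw t.
  have [l [l1 cl]] := @segment_compact R (-1) 1 ((fun w : R -> R => w t) @ G) _ Gt.
  exists l; first by move: l1; rewrite /= in_itv.
  move=> B nB; have [//|nGB] := in_ultra_setVsetC ((fun w : R -> R => w t) @^-1` B) UG.
  by have [x [/= nBx Bx]] := cl (~` B) B nGB nB.
pose u t := projT1 (cid2 (lims t)).
have uP t : -1 <= u t <= 1 /\ ((fun w : R -> R => w t) @ G --> u t).
  by rewrite /u; case: (cid2 (lims t)).
have near_u t eta : 0 < eta -> G [set w | `|u t - w t| <= eta].
  by move=> e0; have [_ /cvgrPdist_le h] := uP t; exact: h.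
have ulip x y : `|u x - u y| <= `|x - y|.
  apply/ler_addgt0Pr => e e0; have e2 : 0 < e / 2 by lra.
  have /filter_ex[w [/= h1 [/= h2 h3]]] := @filterI _ _ GF _ _ (near_u x _ e2) (@filterI _ _ GF _ _ (near_u y _ e2) (GK 1 ltr01)).
  have h4 := Klip _ _ h3 x y.
  have -> : u x - u y = (u x - w x) - (u y - w y) + (w x - w y) by ring.
  have := ler_normD ((u x - w x) - (u y - w y)) (w x - w y).
  have := ler_normB (u x - w x) (u y - w y); lra.
exists u; split => //; first by move=> t; exact: (uP t).1.
move=> T eta T0 e0.
pose h := eta / 3; have h0 : 0 < h by rewrite /h; lra.
pose N := (Num.truncn (2 * T / h)).+1.
have near_net : G [set w | forall i : 'I_N, `|u (- T + i%:R * h) - w (- T + i%:R * h)| <= h].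
  by apply: filter_forall => i; exact: near_u.
have /filter_ex[w [hw Kw]] := @filterI _ _ GF _ _ near_net (GK _ e0); exists w => // t; rewrite ler_norml => /andP[t1 t2].
have tT0 : 0 <= (t + T) / h by rewrite divr_ge0//; lra.
have /andP[i1 i2] := Num.Theory.truncn_itv tT0.
set i := Num.truncn ((t + T) / h) in i1 i2.
have iN : (i < N)%N.
  by rewrite ltnS; apply: Num.Theory.le_truncn; rewrite ler_pM2r ?invr_gt0//; lra.
have := hw (Ordinal iN) => /=; set s := - T + i%:R * h => hs.
have ts : `|t - s| <= h.
  move: i1 i2; rewrite ler_pdivlMr// ltr_pdivrMr// -natr1 mulrDl mul1r => i1 i2.
  by rewrite /s ler_norml; lra.
have l1 := Klip _ _ Kw t s; have l2 := ulip t s.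
have -> : w t - u t = (w t - w s) - (u t - u s) - (u s - w s) by ring.
have := ler_normB ((w t - w s) - (u t - u s)) (u s - w s).
have := ler_normB (w t - w s) (u t - u s).
by rewrite /h in hs ts; lra.
Qed.

Lemma lam_intZ (k : R) f : leb_measurable f -> (forall t, 0 <= f t) -> 0 <= k ->
  (\int[lam R]_t (k * f t)%:E = k%:E * \int[lam R]_t (f t)%:E)%E.
Proof.
move=> mf f0 k0.
exact: (@ge0_integralZl_EFin _ _ _ (lam R) setT measurableT (EFin \o f) (EFin_ge0 f0) (leb_EFin mf)).
Qed.

(** If [w] were close to [-1] at some [t] far to the right, then cutting it at
    [t] would produce, at small cost, a function resting at [-1] until shortly
    before [t]. From there on the two weights differ by at most [eta * a1], so its
    [b]-energy is at most [1 + eta] times its [a]-energy, which is below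
    [r2]. *)
Lemma transition_window W a b (a1 a2 M r1 r2 : R) : continuous W -> (forall s, 0 <= W s) -> W (-1) = 0 -> W 1 = 0 ->
  leb_measurable a -> leb_measurable b -> 0 < a1 -> (forall t, a1 <= a t <= a2) ->
  (forall t, a t <= b t) -> (forall s, -1 <= s <= 1 -> W s <= M) ->
  b t - a t @[t --> -oo] --> (0 : R) -> b t - a t @[t --> +oo] --> (0 : R) ->
  r1 < r2 -> (forall w g, admissible w g -> (r2%:E <= \int[lam R]_t (energy W b w g t)%:E)%E) ->
  exists d T : R, 0 < d /\ forall w g, admissible w g -> (forall t, -1 <= w t <= 1) ->
    (\int[lam R]_t (energy W a w g t)%:E <= r1%:E)%E ->
    (forall t, T <= t -> -1 + d <= w t) /\ (forall t, t <= - T -> w t <= 1 - d).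
Proof.
move=> cW W0 Wm1 W1 ma mb a10 a12 ab WM bl br r12 infb.
have a0C t : 0 <= a t <= a2 by have := a12 t; lra.
have K0 : 0 <= a2 * M by rewrite mulr_ge0 ?(weight_bound_ge0 a0C) ?(well_bound_ge0 W1 WM).
pose d := Num.min 1 ((r2 - r1) / 4 / (1 + a2 * M)).
have d0 : 0 < d by rewrite lt_min ltr01 !divr_gt0//; lra.
have d1 : d <= 1 by rewrite ge_min lexx.
have Kd : (1 + a2 * M) * d <= (r2 - r1) / 4.
  by rewrite mulrC -ler_pdivlMr ?ge_min ?lexx ?orbT//; lra.
have nr := normr_ge0 r1.
pose eta := (r2 - r1) / 4 / (`|r1| + (r2 - r1) / 4 + 1).
have eta0 : 0 < eta by rewrite !divr_gt0//; lra.
have heta : eta * (`|r1| + (r2 - r1) / 4 + 1) = (r2 - r1) / 4.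
  by rewrite /eta divfK// gt_eqF//; lra.
have ea0 : 0 < eta * a1 by rewrite mulr_gt0.
move/cvgrPdist_le : bl => /(_ _ ea0)[A [_ hA]].
move/cvgrPdist_le : br => /(_ _ ea0)[B [_ hB]].
clearbody eta.
have strict : (1 + eta) * (r1 + (1 + a2 * M) * d) < r2.
  have : eta * (r1 + (1 + a2 * M) * d) <= eta * (`|r1| + (r2 - r1) / 4 + 1).
    by apply: ler_wpM2l; [exact: ltW|have := ler_norm r1; lra].
  by rewrite heta; lra.
(* Wherever w is off the zeros of W, the two weights nearly agree. *)
have cmp w g : admissible w g -> (forall t, `|b t - a t| <= eta * a1 \/ (W (w t) = 0)) ->
    (\int[lam R]_t (energy W a w g t)%:E <= (r1 + (1 + a2 * M) * d)%:E)%E -> False.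
  move=> wg hfar Ea.
  have Ea0 t : 0 <= energy W a w g t by apply: (energy_ge0 W0 a0C).
  have dw : primitive w g by case: wg.
  have mE := energy_measurable ma cW dw.
  have := infb _ _ wg; apply/negP; rewrite -ltNge.
  apply: (@le_lt_trans _ _ ((1 + eta)%:E * (r1 + (1 + a2 * M) * d)%:E)%E); last first.
    by rewrite -EFinM lte_fin.
  apply: (@le_trans _ _ ((1 + eta)%:E * \int[lam R]_t (energy W a w g t)%:E)%E); last first.
    by apply: lee_wpmul2l => //; rewrite lee_fin; lra.
  rewrite -(lam_intZ mE Ea0); last by lra.
  apply: lam_le_int.
  - exact: measurableT.
  - exact: energy_measurable.
  - by apply: lebM => //; exact: measurable_cst.
  - move=> t; rewrite addr_ge0 ?kinetic_ge0// mulr_ge0//; have := a0C t; have := ab t; lra.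
  move=> t _; rewrite /energy; have k0 := kinetic_ge0 (g t); have w0 := W0 (w t).
  have [h|->] := hfar t; last by rewrite !mulr0 !addr0; nra.
  have hb : b t <= (1 + eta) * a t.
    have := a12 t; move: h; rewrite ler_norml; nra.
  have := ler_wpM2r w0 hb; nra.
exists d, (`|A| + `|B| + 2); split => // w g wg w1 Ew.
have far_r t : `|B| + 1 < t -> `|b t - a t| <= eta * a1.
  by move=> Bt; have := hB t; rewrite sub0r normrN; apply; have := ler_norm B; lra.
have far_l t : t < - (`|A| + 1) -> `|b t - a t| <= eta * a1.
  by move=> tA; have := hA t; rewrite sub0r normrN; apply; have := ler_norm (- A); rewrite normrN; lra.
have nA := normr_ge0 A; have nB := normr_ge0 B.
split=> t tT; rewrite leNgt; apply/negP => wt.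
- have [w2 [h2 [wh2 _ e2 _ E2]]] := lcut_energy cW W0 Wm1 W1 ma a0C WM wg (w1 t).
  apply: (cmp w2 h2) => //.
    move=> s; have [st|ts] := leP s (t - (w t + 1)).
      by right; rewrite (e2 _ st).1.
    by left; apply: far_r; move: ts tT wt d1 nA; clear; lra.
  apply: (le_trans E2); rewrite EFinD; apply: leeD => //.
  by rewrite lee_fin ler_wpM2l//; [move: K0|move: wt]; clear; lra.
- have [w2 [h2 [wh2 _ e2 _ E2]]] := rcut_energy cW W0 W1 ma a0C WM wg (w1 t).
  apply: (cmp w2 h2) => //.
    move=> s; have [st|ts] := leP s (t + (1 - w t)).
      by left; apply: far_l; move: st tT wt d1 nB; clear; lra.
    by right; rewrite (e2 _ ts).1.
  apply: (le_trans E2); rewrite EFinD; apply: leeD => //.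
  by rewrite lee_fin ler_wpM2l//; [move: K0|move: wt]; clear; lra.
Qed.

(** Beyond [T] the values of [u] avoid a neighbourhood of the wrong well, so
    [W (u t)] tending to 0 leaves only the right one. *)
Lemma limit_of_vanish W u (d T : R) : continuous W -> 
  (forall s : R, s != -1 -> s != 1 -> 0 < W s) -> 0 < d ->
  (forall t, -1 <= u t <= 1) ->
  (forall t, T <= t -> -1 + d <= u t) -> (forall t, t <= - T -> u t <= 1 - d) ->
  (fun t => W (u t)) @ -oo --> (0 : R) -> (fun t => W (u t)) @ +oo --> (0 : R) ->
  u @ -oo --> (-1 : R) /\ u @ +oo --> (1 : R).
Proof.
move=> cW Wpos d0 u1 uR uL WL WR; split; apply/cvgrPdist_le => e e0.
- have [|c c0 hc] := @pos_lower_bound R W (-1 + e) (1 - d) cW.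
    by move=> s hs; apply: Wpos; apply/eqP; lra.
  have c2 : 0 < c / 2 by lra.
  move/cvgrPdist_le : WL => /(_ _ c2)[A [_ hA]].
  exists (Num.min A (- T)); split; first exact: num_real.
  move=> t; rewrite lt_min => /andP[/hA tA /ltW/uL ut].
  have h1 : u t < -1 + e.
    rewrite ltNge; apply/negP => h; have := hc (u t); rewrite h ut => /(_ isT) cW'.
    by move: tA; rewrite sub0r normrN ler_norml; lra.
  by have := u1 t; rewrite ler_norml; lra.
- have [|c c0 hc] := @pos_lower_bound R W (-1 + d) (1 - e) cW.
    by move=> s hs; apply: Wpos; apply/eqP; lra.
  have c2 : 0 < c / 2 by lra.
  move/cvgrPdist_le : WR => /(_ _ c2)[A [_ hA]].
  exists (Num.max A T); split; first exact: num_real.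
  move=> t; rewrite gt_max => /andP[/hA tA /ltW/uR ut].
  have h1 : 1 - e < u t.
    rewrite ltNge; apply/negP => h; have := hc (u t); rewrite h ut => /(_ isT) cW'.
    by move: tA; rewrite sub0r normrN ler_norml; lra.
  by have := u1 t; rewrite ler_norml; lra.
Qed.

End compactness.

(** * Existence of the minimizer *)

Theorem theorem1p2 (R : realType) (W a : R -> R)
  (W_C1 : C1 W) (W_m1 : W (-1) = 0) (W_1 : W 1 = 0)
  (W_gt0 : forall s : R, s != -1 -> s != 1 -> 0 < W s)
  (a_meas : leb_measurable a)
  (a_bounds : exists a1 a2 : R, 0 < a1 /\ forall t, a1 <= a t <= a2)
  (b_exists : exists b : R -> R,
    [/\ Lp +oo%E b,
        forall t, a t <= b t,
        b t - a t @[t --> -oo] --> (0 : R),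
        b t - a t @[t --> +oo] --> (0 : R) &
        exists v, attains_inf_at (lagrangian_action W b) X1 v]) :
  exists u : R -> R,
    attains_inf_at (lagrangian_action W a) X1 u /\
    [/\ C1 u,
        W22_loc u,
        weak_derivative (fun t => derive1 u t / Num.sqrt (1 - `|derive1 u t| ^+ 2))
                        (fun t => a t * derive1 W (u t)),
        [/\ (u t, derive1 u t) @[t --> -oo] --> (-1 : R, 0 : R) &
            (u t, derive1 u t) @[t --> +oo] --> (1 : R, 0 : R)] &
        (Linfty_norm (derive1 u) < 1)%E].
Proof.
have [a1 [a2 [a10 a12]]] := a_bounds; have [b [b_oo ab bl br [v [vX vE]]]] := b_exists.
have cW : continuous W := primitive_continuous (C1_primitive W_C1).
have W0 s : 0 <= W s.
  have [->|s1] := eqVneq s (-1); first by rewrite W_m1.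
  have [->|s2] := eqVneq s 1; first by rewrite W_1.
  exact/ltW/W_gt0.
have [N hN] := (loc_bdd_continuous cW).2 1.
have WM s : -1 <= s <= 1 -> W s <= N.
  by move=> s1; apply: le_trans (ler_norm _) (hN _ _); rewrite ler_norml.
have a0C t : 0 <= a t <= a2 by have := a12 t; lra.
have mb : leb_measurable b.
  by move: b_oo; rewrite /Lp /= inE => /andP[]; rewrite inE.
have E0 w g t : 0 <= energy W a w g t := energy_ge0 W0 a0C w g t.
set La := lagrangian_action W a.
pose ma := ereal_inf [set La w | w in X1].
have LaE w g : admissible w g -> La w = (\int[lam R]_t (energy W a w g t)%:E)%E.
  by move=> [dw _ _ _]; exact: action_admissible.
have ge_ma w g : admissible w g -> (ma <= \int[lam R]_t (energy W a w g t)%:E)%E.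
  by move=> wg; rewrite -(LaE _ _ wg); apply: ereal_inf_lbound; exists w => //; exact: admissible_X1 wg.
have ma_ge0 : (0 <= ma)%E.
  apply: le_ereal_inf_tmp => _ [w /X1_admissible[g wg _] <-]; rewrite (LaE _ _ wg).
  by apply: integral_ge0 => t _; rewrite lee_fin.
have ma_fin : ma \is a fin_num.
  have [w [g [wg fin]]] := finite_energy cW W0 W_m1 W_1 a_meas a0C WM.
  by rewrite ge0_fin_numE//; apply: le_lt_trans (ge_ma _ _ wg) fin.
pose m := fine ma; have mE : ma = m%:E by rewrite /m fineK.
have inf_m w g : admissible w g -> (m%:E <= \int[lam R]_t (energy W a w g t)%:E)%E.
  by rewrite -mE; exact: ge_ma.
have near_min eta : 0 < eta -> exists w g, [/\ admissible w g, forall t, -1 <= w t <= 1 &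
    (\int[lam R]_t (energy W a w g t)%:E <= (m + eta)%:E)%E].
  move=> e0; have [_ [w /X1_admissible[g wg _] <-] hw] := lb_ereal_inf_adherent e0 ma_fin.
  have [w' [g' [wg' w1 E]]] := truncation cW W0 W_m1 W_1 a_meas a0C WM wg.
  exists w', g'; split => //; apply: (le_trans E).
  by rewrite -(LaE _ _ wg) EFinD -mE ltW.
(* What remains is a bounded limit of near-minimizers with the right behaviour at infinity. *)
have finish u M : (forall t, `|u t| <= M) -> (forall x y, `|u x - u y| <= `|x - y|) ->
    (forall T eta : R, 0 < T -> 0 < eta -> exists w g, [/\ admissible w g,
      (\int[lam R]_t (energy W a w g t)%:E <= (m + eta)%:E)%E &
      forall t, `|t| <= T -> `|w t - u t| <= eta]) ->
    ((fun t => W (u t)) @ -oo --> (0 : R) -> (fun t => W (u t)) @ +oo --> (0 : R) ->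
      u @ -oo --> (-1 : R) /\ u @ +oo --> (1 : R)) ->
    attains_inf_at La X1 u /\ [/\ C1 u, W22_loc u,
      weak_derivative (momentum u) (fun t => a t * derive1 W (u t)),
      [/\ (u t, derive1 u t) @[t --> -oo] --> (-1 : R, 0 : R) &
          (u t, derive1 u t) @[t --> +oo] --> (1 : R, 0 : R)] &
      (Linfty_norm (derive1 u) < 1)%E].
  move=> uM ulip approx lims.
  have hcore := near_min_limit W_C1 W0 a_meas a0C uM ulip inf_m approx.
  have [WL WR] := W_vanish W_C1 W0 a_meas a10 a12 uM hcore.
  have [ul ur] := lims WL WR.
  have ua := u_admissible hcore ul ur.
  split; last exact: (conclusion W_C1 a10 a12 uM hcore ul ur).
  split; first exact: admissible_X1 ua.
  apply/eqP; rewrite eq_le; apply/andP; split; last by rewrite (LaE _ _ ua); exact: ge_ma.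
  by rewrite (LaE _ _ ua) -/ma mE; exact: (u_energy W_C1 W0 a_meas a10 a12 hcore).
suff [u [M [uM [ulip [approx lims]]]]] : exists u M, (forall t, `|u t| <= M) /\
    (forall x y, `|u x - u y| <= `|x - y|) /\
    (forall T eta : R, 0 < T -> 0 < eta -> exists w g, [/\ admissible w g,
      (\int[lam R]_t (energy W a w g t)%:E <= (m + eta)%:E)%E &
      forall t, `|t| <= T -> `|w t - u t| <= eta]) /\
    ((fun t => W (u t)) @ -oo --> (0 : R) -> (fun t => W (u t)) @ +oo --> (0 : R) ->
      u @ -oo --> (-1 : R) /\ u @ +oo --> (1 : R)).
  by exists u; exact: finish uM ulip approx lims.
have [gv vg _] := X1_admissible vX.
set mb' := ereal_inf _ in vE.
have Lb_ge w g : admissible w g -> (mb' <= \int[lam R]_t (energy W b w g t)%:E)%E.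
  move=> wg; rewrite -(@action_admissible _ W b w g mb cW); last by case: wg.
  by apply: ereal_inf_lbound; exists w => //; exact: admissible_X1 wg.
(* If the infimum for b is not larger, its minimizer v is also one for a. *)
have [mba|mab] := leP mb' ma.
  have [M M0 vM] := admissible_bounded vg.
  exists v, M; split => //; split; first by move=> x y; exact: admissible_lip vg.
  split; last by move=> _ _; case: vX.
  move=> T eta T0 e0; exists v, gv; split => //; last first.
    by move=> t _; rewrite subrr normr0 ltW.
  apply: (@le_trans _ _ (\int[lam R]_t (energy W b v gv t)%:E)%E).
    have dv : primitive v gv by case: vg.
    apply: lam_le_int => //; [exact: energy_measurable|exact: energy_measurable|].
    by move=> t _; rewrite lerD2l ler_wpM2r.
  rewrite -(@action_admissible _ W b v gv mb cW); last by case: vg.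
  by rewrite vE EFinD -mE; apply: le_trans mba _; rewrite leeDl// lee_fin ltW.
have [r2 mr2 r2b] : exists2 r2, m < r2 & (r2%:E <= mb')%E.
  move: mab; rewrite mE; case: (mb') => [r| |]//=.
    by rewrite lte_fin => mr; exists r.
  by move=> _; exists (m + 1); [rewrite ltrDl|rewrite leey].
pose r1 := (m + r2) / 2.
have r12 : r1 < r2 by rewrite /r1; lra.
have mr1 : 0 < r1 - m by rewrite /r1; lra.
have [d [T0 [d0 barrier]]] := transition_window cW W0 W_m1 W_1 a_meas mb a10 a12 ab WM bl br r12
  (fun w g wg => le_trans r2b (Lb_ge w g wg)).
(* Near-minimizers are taken below the level r1, where the transition is confined. *)
pose K (eta : R) : set (R -> R) := [set w | exists g, [/\ admissible w g, forall t, -1 <= w t <= 1 &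
  (\int[lam R]_t (energy W a w g t)%:E <= (m + Num.min eta (r1 - m))%:E)%E]].
have [u [u1 ulip approx]] : exists u, [/\ forall t, -1 <= u t <= 1, forall x y, `|u x - u y| <= `|x - y| &
    forall T eta, 0 < T -> 0 < eta -> exists2 w, K eta w & forall t, `|t| <= T -> `|w t - u t| <= eta].
  apply: lip_compact.
  - move=> eta e0; have [|w [g h]] := near_min (Num.min eta (r1 - m)); first by rewrite lt_min e0.
    by exists w, g.
  - move=> e e' ee' w [g [wg w1 Ew]]; exists g; split => //; apply: (le_trans Ew).
    by rewrite lee_fin lerD2l le_min !ge_min ee' lexx orbT.
  - by move=> e w [g []].
  - by move=> e w [g [wg _ _]] x y; exact: admissible_lip wg.
exists u, 1; split; first by move=> t; rewrite ler_norml.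
split => //; split.
  move=> T eta T1 e0; have [w [g [wg w1 Ew]] hw] := approx T eta T1 e0; exists w, g; split => //.
  by apply: (le_trans Ew); rewrite lee_fin lerD2l ge_min lexx.
have [bR bL] : (forall t, T0 <= t -> -1 + d <= u t) /\ (forall t, t <= - T0 -> u t <= 1 - d).
  have pick t e : 0 < e -> exists2 w, `|w t - u t| <= e &
      (forall t, T0 <= t -> -1 + d <= w t) /\ (forall t, t <= - T0 -> w t <= 1 - d).
    move=> e0; have t1 : 0 < `|t| + 1 by rewrite ltr_wpDl.
    have [w [g [wg w1 Ew]] hw] := approx _ _ t1 e0.
    exists w; first by apply: hw; rewrite lerDl.
    apply: (barrier w g wg w1); apply: (le_trans Ew).
    rewrite lee_fin -lerBrDl ge_min lexx orbT//.
  split=> t tT; apply/ler_addgt0Pr => e e0; have [w wu [h1 h2]] := pick t e e0.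
    by have := h1 _ tT; move: wu; rewrite ler_norml; clear; lra.
  by have := h2 _ tT; move: wu; rewrite ler_norml; clear; lra.
by apply: limit_of_vanish bR bL.
Qed.
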